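(* Fix $\sigma^2>0$. For $n\in\mathbb N$ let $\mu_{n;\sigma^2}:=\frac1n\sum_{z\in\mathbb T:\,H_n(z;\sigma^2/n)=0}\delta_z$ be the empirical distribution of zeroes (counted with multiplicities) of the unitary Hermite polynomial $H_n(\,\cdot\,;\sigma^2/n)$. Then, as $n\to\infty$, the probability measures $\mu_{n;\sigma^2}$ converge weakly on $\mathbb T$ to the free unitary normal distribution $\mathfrak N_{\sigma^2}$ with parameter $\sigma^2$.
   Context: $\mathbb D=\{z\in\mathbb C:|z|<1\}$, $\mathbb T=\{z\in\mathbb C:|z|=1\}$. Unitary Hermite polynomials: for $n\in\mathbb N$ and $s>0$, $H_n(z;s)=\sum_{j=0}^n(-1)^{n-j}\binom nj \exp\{-\tfrac{s\,j(n-j)}{2}\}z^j$. It is known (Lee--Yang theorem) that all zeroes of $H_n(\cdot;s)$ lie on $\mathbb T$, so $\mu_{n;\sigma^2}$ is a probability measure on $\mathbb T$. For a probability measure $\mu$ on $\mathbb T$, the $\psi$-transform is $\psi_\mu(z)=\int_{\mathbb T}\frac{uz}{1-uz}\mu(du)=\sum_{\ell\ge1}z^\ell\int_{\mathbb T}u^\ell\mu(du)$, $z\in\mathbb D$. If $\psi_\mu'(0)=\int_{\mathbb T} u\,\mu(du)\neq0$, then $\psi_\mu$ has an analytic inverse $\psi_\mu^{-1}$ near $0$ and the $S$-transform is $S_\mu(z)=\frac{1+z}{z}\psi_\mu^{-1}(z)$. The free unitary normal distribution $\mathfrak N_{\sigma^2}$, $\sigma^2>0$, is the (unique) probability measure on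 $\mathbb T$ with $S_{\mathfrak N_{\sigma^2}}(z)=e^{\sigma^2(z+\frac12)}$ for $z$ near $0$. *)

(* Defs.v *)
From HB Require Import structures.
From mathcomp Require Import all_boot all_order all_algebra.
From mathcomp Require Import complex.
From mathcomp Require Import all_classical all_reals all_analysis.

Set Implicit Arguments.
Unset Strict Implicit.
Unset Printing Implicit Defensive.

Import Order.TTheory GRing.Theory Num.Theory.
Import numFieldNormedType.Exports.

Local Open Scope classical_set_scope.
Local Open Scope complex_scope.
Local Open Scope ring_scope.

(* Bundling [R[i]] as a [numClosedFieldType] is what gives it the topology and
   the normed module structure (over itself) that MathComp-Analysis attaches to
   numeric fields, so that [derivable] below is complex differentiability. *)
Definition C (R : realType) : numClosedFieldType := R[i].

Definition ofR (R : realType) (x : R) : C R := x%:C.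

Definition Cexp (R : realType) (z : C R) : C R :=
  (expR (complex.Re z) * cos (complex.Im z)) +i*
  (expR (complex.Re z) * sin (complex.Im z)).

(* The unit circle as a type, with the topology induced by the inclusion
   [val : circle R -> C R]. *)
Definition circle (R : realType) : Type := set_type [set z : C R | `|z| = 1].

HB.instance Definition _ (R : realType) := SubType.on (circle R).
HB.instance Definition _ (R : realType) :=
  Topological.copy (circle R) (set_type [set z : C R | `|z| = 1]).

Definition circle1 (R : realType) : circle R :=
  exist _ (1 : C R) (mem_set (normr1 (C R))).

HB.instance Definition _ (R : realType) := isPointed.Build (circle R) (circle1 R).

Definition borel_circle (R : realType) := g_sigma_algebraType (@open (circle R)).

Definition hermite (R : realType) (n : nat) (s : R) : {poly C R} :=
  \poly_(j < n.+1) ((-1) ^+ (n - j) * 'C(n, j)%:R *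
                    ofR (expR (- (s * j%:R * (n - j)%:R / 2)))).

(* The zeroes of [p] (for [p != 0]) that lie on the circle, each repeated
   according to its multiplicity. *)
Definition circle_zeros (R : realType) (p : {poly C R}) : seq (circle R) :=
  pmap insub (sval (closed_field_poly_normal p)).

Definition empirical_zeros (R : realType) (sigma2 : R) (n : nat) :
    {measure set (borel_circle R) -> \bar R} :=
  let s := circle_zeros (hermite n (sigma2 / n%:R)) in
  mscale (n%:R^-1)%:nng
    (msum (fun i => \d_(nth (circle1 R) s i : borel_circle R)) (size s)).

(* The circle is compact, so every continuous function on it is bounded. *)
Definition weak_cvg (R : realType)
    (mu : nat -> {measure set (borel_circle R) -> \bar R})
    (nu : {measure set (borel_circle R) -> \bar R}) : Prop :=
  forall f : circle R -> R, continuous f ->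
    \int[mu n]_u f u @[n --> \oo] --> \int[nu]_u f u.

Definition Cintegral (R : realType)
    (mu : {measure set (borel_circle R) -> \bar R}) (f : circle R -> C R) : C R :=
  (\int[mu]_u complex.Re (f u)) +i* (\int[mu]_u complex.Im (f u)).

(* Only meaningful for [`|z| < 1]. *)
Definition psi_transform (R : realType)
    (mu : {measure set (borel_circle R) -> \bar R}) (z : C R) : C R :=
  Cintegral mu (fun u => val u * z / (1 - val u * z)).

Definition analytic_inverse_at0 (R : realType) (f g : C R -> C R) : Prop :=
  [/\ \forall z \near (0 : C R), derivable g z 1,
      g 0 = 0,
      \forall z \near (0 : C R), f (g z) = z &
      \forall z \near (0 : C R), g (f z) = z].

(* [S] agrees near 0 with the S-transform of [mu]. The inverse of the
   psi-transform is only determined as a germ at 0, and the factor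
   [(1 + z) / z] has a removable singularity there, hence the punctured
   neighbourhood. *)
Definition has_S_transform (R : realType)
    (mu : {measure set (borel_circle R) -> \bar R}) (S : C R -> C R) : Prop :=
  Cintegral mu (fun u => val u) != 0 /\
  exists2 g : C R -> C R, analytic_inverse_at0 (psi_transform mu) g &
    \forall z \near (0 : C R)^', S z = (1 + z) / z * g z.

Definition free_unitary_normal (R : realType) (sigma2 : R)
    (nu : probability (borel_circle R) R) : Prop :=
  has_S_transform nu (fun z => Cexp (ofR sigma2 * (z + 2^-1))).

(* Main.v *)
From HB Require Import structures.
Require Import Defs.
From mathcomp Require Import all_boot all_order all_algebra.
From mathcomp Require Import cyclic separable cyclotomic.
From mathcomp Require Import complex.
From mathcomp Require Import all_classical all_reals all_analysis.
From mathcomp Require Import measurable_realfun zify ring lra.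

(* With a = exp(-sigma2 / 2n), the polynomials H_n(z) satisfy
   H_{n+1}(z) = a^n z H_n(z / a) - H_n(a z), which gives the Lee-Yang theorem by
   induction: |a z - u| >= |z - a u| for every |u| = 1 when |z| < 1, and the
   reverse inequality holds when |z| > 1.

   For small real z > 0 put t_n(z) = - z H_n'(z) / (n H_n(z)), which is the
   psi-transform of the zeros of H_n, and b = a^-2.  The q-difference equation
   - H_n'(z) = a^(n-1) (n H_n(b z) - b z H_n'(b z)) reads
   t_n(z) = z a^(n-1) (H_n(b z) / H_n(z)) (1 + t_n(b z)).
   Since the zeros are unimodular and n (b - 1) -> sigma2, the quotient
   H_n(b z) / H_n(z) is exp(- sigma2 t_n(z)) up to a factor tending to 1, so t_n
   almost satisfies t = z (1 + t) exp(- sigma2 (t + 1/2)).  The psi-transform of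
   the free unitary normal law satisfies this equation exactly, and for small z
   the right-hand side is a contraction, so t_n(z) tends to it.  Moments are
   then recovered one at a time by letting z tend to 0, and trigonometric
   polynomials suffice by a Korovkin argument. *)

Set Implicit Arguments.
Unset Strict Implicit.
Unset Printing Implicit Defensive.

Import Order.TTheory GRing.Theory Num.Theory.
Import numFieldNormedType.Exports.

Local Open Scope classical_set_scope.
Local Open Scope ring_scope.

(** * The polynomials and their recursions *)

(** With [a] = exp(-s/2) as parameter the Gaussian weights become powers, so one definition serves
    over R and over C and the recursions are ring identities. *)
Definition herm (F : comNzRingType) (a : F) (n : nat) : {poly F} :=
  \poly_(j < n.+1) ((-1) ^+ (n - j) * 'C(n, j)%:R * a ^+ (j * (n - j))).

Lemma coef_herm (F : comNzRingType) (a : F) n j :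
  (herm a n)`_j = (-1) ^+ (n - j) * 'C(n, j)%:R * a ^+ (j * (n - j)).
Proof.
rewrite coef_poly ltnS; case: leqP => // nj.
by rewrite bin_small// mulr0 mul0r.
Qed.

Lemma size_herm (F : comNzRingType) (a : F) n : size (herm a n) = n.+1.
Proof.
by rewrite size_poly_eq// subnn muln0 binn !expr0 !mulr1 oner_neq0.
Qed.

Lemma monic_herm (F : comNzRingType) (a : F) n : herm a n \is monic.
Proof.
by rewrite monicE lead_coefE size_herm coef_herm subnn muln0 binn !mulr1.
Qed.

Lemma map_herm (F G : comNzRingType) (f : {rmorphism F -> G}) (a : F) n :
  map_poly f (herm a n) = herm (f a) n.
Proof.
apply/polyP => j; rewrite coef_map !coef_herm [LHS]/=.
by rewrite !rmorphM !rmorphXn rmorphN1 rmorph_nat.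
Qed.

(** Coefficientwise this is Pascal's rule: the exponent (j+1)(n-j) equals both j(n-j) + n - j and
    (j+1)(n-j-1) + (j+1), which accounts for the rescalings by 1/a and by a. *)
Lemma herm_rec (F : fieldType) (a : F) n z : a != 0 ->
  (herm a n.+1).[z] = a ^+ n * z * (herm a n).[z / a] - (herm a n).[a * z].
Proof.
move=> a0.
have E (m : nat) x : (m >= n.+1)%N ->
    (herm a n).[x] = \sum_(j < m) (herm a n)`_j * x ^+ j.
  by move=> nm; apply: horner_coef_wide; rewrite size_herm.
rewrite horner_coef size_herm big_ord_recl expr0 mulr1.
rewrite (E n.+1 (z / a))// (E n.+2 (a * z))// [X in _ - X]big_ord_recl.
rewrite expr0 mulr1 opprD addrCA; congr (_ + _).
  rewrite !coef_herm !bin0 !mul0n !subn0 !expr0 exprS; ring.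
rewrite mulr_sumr -sumrB; apply: eq_bigr => -[j ltjn] _ /=.
rewrite !coef_herm /bump /= add1n subSS binS natrD !exprMn exprVn.
(* The top coefficient is separate, because n - (j+1) is a truncated subtraction when j = n. *)
case: (leqP j.+1 n) => jn; last first.
  have jn' : j = n by apply/eqP; rewrite eqn_leq -ltnS ltjn /= -ltnS.
  rewrite jn' subnn !muln0 !expr0 binn bin_small// !mulr0 !mul0r subr0 !exprS.
  by field; rewrite expf_neq0.
have [k ->] : exists k, n = (j + k.+1)%N by exists (n - j.+1)%N; rewrite addnS -addSn subnKC.
have -> : (j + k.+1 - j)%N = k.+1 by rewrite addKn.
have -> : (j + k.+1 - j.+1)%N = k by rewrite -addSnnS addKn.
rewrite mulSn !mulnS !exprD !exprS.
by field; rewrite expf_neq0.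
Qed.

(** On the right the j-th coefficient of H is multiplied by n+1-j, which kills the top degree. The
    rest is (j+1) C(n+1, j+1) = (n+1-j) C(n+1, j), the powers of [a] being absorbed by the dilation
    by a^-2. *)
Lemma herm_qdiff (F : fieldType) (a : F) n z : a != 0 ->
  - (herm a n.+1)^`().[z] =
  a ^+ n * (n.+1%:R * (herm a n.+1).[z / a ^+ 2]
            - z / a ^+ 2 * (herm a n.+1)^`().[z / a ^+ 2]).
Proof.
move=> a0; set p := herm a n.+1.
have sd : (size p^`() <= n.+1)%N.
  by rewrite (leq_trans (size_poly _ _))// size_herm.
rewrite (horner_coef_wide z sd).
set b := z / _.
have -> : b * p^`().[b] = ('X * p^`()).[b] by rewrite hornerM hornerX.
rewrite (@horner_coef_wide _ n.+2 p) ?size_herm//.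
rewrite (@horner_coef_wide _ n.+2 ('X * _)); last first.
  apply: leq_trans (size_polyMleq _ _) _; rewrite size_polyX addSn/= add1n ltnS.
  exact: sd.
rewrite mulr_sumr -sumrB mulr_sumr -sumrN [in RHS]big_ord_recr /=.
rewrite [X in _ = _ + X](_ : _ = 0) ?addr0; last first.
  by rewrite coefXM/= coef_deriv /p -mulr_natl; ring.
apply: eq_bigr => -[j/= jn] _.
rewrite coefXM; have -> : (if j == 0%N then 0 else p^`()`_j.-1) = p`_j * j%:R.
  by case: j jn => [|j] _ /=; rewrite ?mulr0// coef_deriv mulr_natr.
rewrite coef_deriv /p !coef_herm /b.
have [k ->] : exists k, n = (j + k)%N by exists (n - j)%N; rewrite subnKC.
rewrite subSS addKn -addnS addKn addnS exprS.
have B : 'C((j + k).+1, j.+1)%:R * j.+1%:R = 'C((j + k).+1, j)%:R * k.+1%:R :> F.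
  by rewrite -!natrM mulnC mul_bin_left mulnC -addnS addKn.
rewrite -mulr_natr.
transitivity ((-1) ^+ k.+1 * ('C((j + k).+1, j.+1)%:R * j.+1%:R) *
              (a ^+ (j.+1 * k) * z ^+ j)); first by rewrite exprS; ring.
rewrite B; set Cb := 'C(_, _)%:R.
rewrite mulSn mulnS exprMn exprVn -exprM mul2n -addnn !exprD [(-1) ^+ k.+1]exprS.
rewrite -[(j + k).+1%:R]natr1 natrD -natr1.
by field; rewrite expf_neq0.
Qed.

(** * The Lee-Yang theorem *)

(** The right-hand side does not involve [u], so in [Lee_Yang] all factors of the two products
    compare in the same direction. *)
Lemma normCB_swap (F : numClosedFieldType) (a z u : F) :
  a \is Num.real -> `|u| = 1 ->
  `|a * z - u| ^+ 2 - `|z - a * u| ^+ 2 = (1 - a ^+ 2) * (1 - `|z| ^+ 2).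
Proof.
move=> ar u1; have uu : u * u^* = 1 by rewrite -normCK u1 expr1n.
have ca : a^* = a by apply/CrealP.
rewrite !normCK !rmorphB !rmorphM /= ca.
rewrite -[in RHS]uu.
suff : (u * u^* - 1) * (u * u^* - z * z^*) = 0.
  by move=> E; rewrite -[LHS]addr0 -E; ring.
by rewrite uu subrr mul0r.
Qed.

Lemma prodr_exp_size (A : comNzRingType) (I : Type) (c : A) (s : seq I) (F : I -> A) :
  c ^+ size s * \prod_(i <- s) F i = \prod_(i <- s) (c * F i).
Proof.
elim: s => [|i s IH]; first by rewrite !big_nil mulr1.
by rewrite !big_cons -IH /= exprS; ring.
Qed.

Theorem Lee_Yang (F : numClosedFieldType) (a : F) n z :
  0 < a -> a <= 1 -> root (herm a n) z -> `|z| = 1.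
Proof.
move=> a0 a1; have ar : a \is Num.real by rewrite ger0_real// ltW.
have an0 : a != 0 by rewrite gt_eqF.
elim: n z => [|n IH] z.
  by rewrite (@size1_polyC _ (herm a 0)) ?size_herm// coef_herm !muln0 bin0 !mulr1 rootC oner_eq0.
have [rs Ers] := closed_field_poly_normal (herm a n).
move: Ers; rewrite (monicP (monic_herm a n)) scale1r => Ers.
have srs : size rs = n.
  by have := size_herm a n; rewrite Ers size_prod_XsubC => -[].
have rs1 u : u \in rs -> `|u| = 1.
  by move=> urs; apply: IH; rewrite Ers root_prod_XsubC.
rewrite rootE herm_rec// subr_eq0 => /eqP E.
have E1 : `|(herm a n).[a * z]| = \prod_(u <- rs) `|a * z - u|.
  by rewrite Ers horner_prod normr_prod; apply: eq_bigr => u _; rewrite hornerXsubC.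
have E2 : `|a ^+ n * (herm a n).[z / a]| = \prod_(u <- rs) `|z - a * u|.
  rewrite Ers -[X in a ^+ X]srs horner_prod prodr_exp_size normr_prod; apply: eq_bigr => u _.
  by rewrite hornerXsubC mulrBr mulrC divfK.
(* At a zero of the next polynomial the recursion says that |z| times the product of the |z - a u|
   equals the product of the |a z - u|. *)
have /(congr1 Num.norm) := E.
rewrite -mulrA [z * _]mulrC mulrA normrM E1 E2 => {}E.
have cmp u : u \in rs -> `|z - a * u| ^+ 2 <= `|a * z - u| ^+ 2 = (0 <= (1 - a ^+ 2) * (1 - `|z| ^+ 2)).
  by move=> urs; rewrite -subr_ge0 (normCB_swap _ ar (rs1 u urs)).
have cmp' u : u \in rs -> `|a * z - u| ^+ 2 <= `|z - a * u| ^+ 2 = ((1 - a ^+ 2) * (1 - `|z| ^+ 2) <= 0).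
  by move=> urs; rewrite -subr_le0 (normCB_swap _ ar (rs1 u urs)).
have a2 : 0 <= 1 - a ^+ 2 by rewrite subr_ge0 expr_le1// ltW.
case: (real_ltgtP (normr_real z) (real1 F)) => // zlt.
(* If |z| < 1, then a z is no zero of the previous polynomial, so both products are positive. The
   factorwise comparison then contradicts [E]. *)
- have P1 : 0 < \prod_(u <- rs) `|a * z - u|.
    rewrite -E1 normr_gt0; apply/eqP => /eqP /IH /eqP.
    by rewrite normrM gtr0_norm// lt_eqF// (le_lt_trans _ zlt)// ler_piMl.
  have P21 : \prod_(u <- rs) `|z - a * u| <= \prod_(u <- rs) `|a * z - u|.
    rewrite big_seq [leRHS]big_seq ler_prod// => u urs; rewrite normr_ge0/=.
    rewrite -(@ler_pXn2r _ 2)// ?nnegrE// cmp// mulr_ge0// subr_ge0.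
    by rewrite expr_le1// ltW.
  have P2 : 0 < \prod_(u <- rs) `|z - a * u|.
    rewrite lt_neqAle eq_sym prodr_ge0// andbT; apply/eqP => P20.
    by move: P1; rewrite -E P20 mul0r ltxx.
  move: P21; rewrite -E -subr_le0 => /le_lt_trans - /(_ (\prod_(u <- rs) `|z - a * u| * (1 - `|z|))).
  rewrite pmulr_rgt0// subr_gt0 => /(_ zlt).
  by rewrite mulrBr mulr1 ltxx.
(* If |z| > 1, the comparison and [E] force the second product to vanish. Then z / a is a zero of
   the previous polynomial, whence |z| = a <= 1. *)
- have P21 : \prod_(u <- rs) `|a * z - u| <= \prod_(u <- rs) `|z - a * u|.
    rewrite big_seq [leRHS]big_seq ler_prod// => u urs; rewrite normr_ge0/=.
    rewrite -(@ler_pXn2r _ 2)// ?nnegrE// cmp'// mulr_ge0_le0// subr_le0.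
    by rewrite expr_ge1// ltW.
  have : \prod_(u <- rs) `|z - a * u| == 0.
    have: \prod_(u <- rs) `|z - a * u| * (`|z| - 1) <= 0.
      by rewrite mulrBr mulr1 E subr_le0.
    rewrite pmulr_lle0 ?subr_gt0// => P0.
    by rewrite eq_le P0 prodr_ge0.
  rewrite -E2 normr_eq0 mulf_eq0 expf_eq0 (negPf an0) andbF/= => /IH /eqP.
  rewrite normrM normfV (gtr0_norm a0) => /eqP za.
  have zE : `|z| = a by rewrite -[a]mul1r -za divfK.
  by move: zlt; rewrite zE => /lt_le_trans/(_ a1); rewrite ltxx.
Qed.

(** * Real polynomials with unimodular roots *)

HB.instance Definition _ (R : realType) :=
  GRing.RMorphism.copy (@ofR R) (real_complex R).

Lemma ler_ofR (R : realType) (x y : R) : (ofR x <= ofR y) = (x <= y).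
Proof. exact: lecR. Qed.

Lemma ltr_ofR (R : realType) (x y : R) : (ofR x < ofR y) = (x < y).
Proof. exact: ltcR. Qed.

Lemma ofR_inj (R : realType) : injective (@ofR R).
Proof. by move=> x y []. Qed.

(** The norm of [C R] takes values in [C R] itself; this real-valued copy lets estimates be carried
    out in the ordered field [R]. *)
Definition Cmod (R : realType) (z : C R) : R := complex.Re `|z|.

Lemma ofR_Cmod (R : realType) (z : C R) : ofR (Cmod z) = `|z|.
Proof. by apply: (@RRe_real _ (`|z| : R[i])); exact: normr_real. Qed.

Lemma Cmod_ge0 (R : realType) (z : C R) : 0 <= Cmod z.
Proof. by rewrite -ler_ofR rmorph0 ofR_Cmod normr_ge0. Qed.

Lemma CmodM (R : realType) (z w : C R) : Cmod (z * w) = Cmod z * Cmod w.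
Proof. by apply: ofR_inj; rewrite rmorphM !ofR_Cmod normrM. Qed.

Lemma CmodV (R : realType) (z : C R) : Cmod z^-1 = (Cmod z)^-1.
Proof. by apply: ofR_inj; rewrite fmorphV !ofR_Cmod normfV. Qed.

Lemma CmodN (R : realType) (z : C R) : Cmod (- z) = Cmod z.
Proof. by rewrite /Cmod normrN. Qed.

Lemma Cmod_distC (R : realType) (z w : C R) : Cmod (z - w) = Cmod (w - z).
Proof. by rewrite /Cmod distrC. Qed.

Lemma CmodX (R : realType) (z : C R) n : Cmod (z ^+ n) = Cmod z ^+ n.
Proof. by apply: ofR_inj; rewrite rmorphXn !ofR_Cmod normrX. Qed.

Lemma CmodD (R : realType) (z w : C R) : Cmod (z + w) <= Cmod z + Cmod w.
Proof. by rewrite -ler_ofR rmorphD !ofR_Cmod ler_normD. Qed.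

Lemma CmodR (R : realType) (x : R) : Cmod (ofR x) = `|x|.
Proof.
apply: ofR_inj; rewrite ofR_Cmod /ofR normc_def /= expr0n addr0 sqrtr_sqr//.
Qed.

Lemma Cmod0 (R : realType) : Cmod (0 : C R) = 0.
Proof. by rewrite /Cmod normr0. Qed.

Lemma Cmod1 (R : realType) : Cmod (1 : C R) = 1.
Proof. by rewrite /Cmod normr1. Qed.

Lemma Cmod_eq1 (R : realType) (z : C R) : `|z| = 1 -> Cmod z = 1.
Proof. by rewrite /Cmod => ->. Qed.

Lemma Cmod_sqr (R : realType) (z : C R) :
  Cmod z ^+ 2 = complex.Re z ^+ 2 + complex.Im z ^+ 2.
Proof.
by apply: ofR_inj; rewrite rmorphXn /= ofR_Cmod; symmetry; exact: add_Re2_Im2.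
Qed.

Lemma Re_le_Cmod (R : realType) (z : C R) : `|complex.Re z| <= Cmod z.
Proof.
rewrite -(@ler_pXn2r _ 2)// ?nnegrE ?Cmod_ge0// Cmod_sqr real_normK ?num_real//.
by rewrite lerDl sqr_ge0.
Qed.

Lemma Im_le_Cmod (R : realType) (z : C R) : `|complex.Im z| <= Cmod z.
Proof.
rewrite -(@ler_pXn2r _ 2)// ?nnegrE ?Cmod_ge0// Cmod_sqr real_normK ?num_real//.
by rewrite lerDr sqr_ge0.
Qed.

Lemma Cmod_le_ReIm (R : realType) (z : C R) :
  Cmod z <= `|complex.Re z| + `|complex.Im z|.
Proof.
rewrite -(@ler_pXn2r _ 2)// ?nnegrE ?Cmod_ge0 ?addr_ge0// Cmod_sqr sqrrD.
rewrite !real_normK ?num_real// addrAC lerDl.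
by rewrite mulrn_wge0// mulr_ge0.
Qed.

Lemma ReD (R : realType) (z w : C R) :
  complex.Re (z + w) = complex.Re z + complex.Re w.
Proof. by case: z w => [? ?] [? ?]. Qed.

Lemma ImD (R : realType) (z w : C R) :
  complex.Im (z + w) = complex.Im z + complex.Im w.
Proof. by case: z w => [? ?] [? ?]. Qed.

Lemma ReN (R : realType) (z : C R) : complex.Re (- z) = - complex.Re z.
Proof. by case: z => [? ?]. Qed.

Lemma ImN (R : realType) (z : C R) : complex.Im (- z) = - complex.Im z.
Proof. by case: z => [? ?]. Qed.

Lemma ReZ (R : realType) (a : R) (z : C R) :
  complex.Re (ofR a * z) = a * complex.Re z.
Proof. by case: z => [x y] /=; rewrite mul0r subr0. Qed.

Lemma ImZ (R : realType) (a : R) (z : C R) :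
  complex.Im (ofR a * z) = a * complex.Im z.
Proof. by case: z => [x y] /=; rewrite mul0r addr0. Qed.

Lemma Re_sum (R : realType) (I : Type) (s : seq I) (F : I -> C R) :
  complex.Re (\sum_(i <- s) F i) = \sum_(i <- s) complex.Re (F i).
Proof.
by elim: s => [|i s IH]; rewrite ?big_nil// !big_cons ReD IH.
Qed.

Lemma Im_sum (R : realType) (I : Type) (s : seq I) (F : I -> C R) :
  complex.Im (\sum_(i <- s) F i) = \sum_(i <- s) complex.Im (F i).
Proof.
by elim: s => [|i s IH]; rewrite ?big_nil// !big_cons ImD IH.
Qed.

Lemma horner_ofR (R : realType) (p : {poly R}) (x : R) :
  (map_poly (@ofR R) p).[ofR x] = ofR p.[x].
Proof. exact: horner_map. Qed.

(** The polynomial is real while its roots are complex: sums over the roots at a real point are then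
    real, and the intermediate value theorem applies. *)
Definition unimodular_roots (R : realType) (p : {poly R}) (rs : seq (C R)) :=
  map_poly (@ofR R) p = \prod_(u <- rs) ('X - u%:P) /\
  forall u, u \in rs -> `|u| = 1.

(* x * cauchy_mean rs x is the psi-transform at x of the empirical distribution
   of rs, when rs is unimodular and stable under conjugation. *)
Definition cauchy_mean (R : realType) (rs : seq (C R)) (x : R) : R :=
  (size rs)%:R^-1 * \sum_(u <- rs) complex.Re (u - ofR x)^-1.

Lemma Cmod_sub_unit (R : realType) (u : C R) (x : R) : `|u| = 1 -> 0 <= x ->
  1 - x <= Cmod (u - ofR x).
Proof.
move=> u1 x0; have := CmodD (u - ofR x) (ofR x).
by rewrite subrK CmodR ger0_norm// (Cmod_eq1 u1) lerBlDr.
Qed.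

Lemma Cmod_inv_sub_unit (R : realType) (u : C R) (x : R) :
  `|u| = 1 -> 0 <= x -> x < 1 -> Cmod (u - ofR x)^-1 <= (1 - x)^-1.
Proof.
move=> u1 x0 x1; rewrite CmodV lef_pV2 ?posrE ?subr_gt0//.
  exact: Cmod_sub_unit.
by rewrite (lt_le_trans _ (Cmod_sub_unit u1 x0))// subr_gt0.
Qed.

Lemma sub_unit_neq0 (R : realType) (u : C R) (x : R) :
  `|u| = 1 -> 0 <= x -> x < 1 -> u - ofR x != 0.
Proof.
move=> u1 x0 x1; apply/eqP => u0.
by have := Cmod_sub_unit u1 x0; rewrite u0 Cmod0 leNgt subr_gt0 x1.
Qed.

Lemma norm_mean_le (R : realType) (T : eqType) (s : seq T) (F : T -> R) (K : R) :
  0 <= K -> (forall u, u \in s -> `|F u| <= K) ->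
  `|(size s)%:R^-1 * \sum_(u <- s) F u| <= K.
Proof.
move=> K0 FK; rewrite normrM normfV normr_nat.
have [->|s0] := eqVneq s [::]; first by rewrite big_nil normr0 mulr0.
rewrite ler_pdivrMl ?ltr0n ?lt0n ?size_eq0//.
rewrite (le_trans (ler_norm_sum _ _ _))//.
have -> : (size s)%:R * K = \sum_(u <- s) K.
  by rewrite big_const_seq count_predT iter_addr_0 mulr_natl.
by rewrite big_seq [leRHS]big_seq ler_sum.
Qed.

Section UnimodularRoots.
Variables (R : realType) (p : {poly R}) (rs : seq (C R)).
Hypothesis hp : unimodular_roots p rs.

Let rs1 u : u \in rs -> `|u| = 1. Proof. exact: hp.2. Qed.

Lemma horner_unimodular x : ofR p.[x] = \prod_(u <- rs) (ofR x - u).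
Proof.
rewrite -horner_ofR hp.1 horner_prod; apply: eq_bigr => u _.
by rewrite hornerXsubC.
Qed.

Lemma unimodular_neq0 x : 0 <= x -> x < 1 -> p.[x] != 0.
Proof.
move=> x0 x1; apply/eqP => px.
have := horner_unimodular x; rewrite px rmorph0 => /esym/eqP.
rewrite big_seq prodf_seq_eq0 => /hasP[u urs]; rewrite urs/= -oppr_eq0 opprB.
by rewrite (negPf (sub_unit_neq0 _ _ _))// rs1.
Qed.

Lemma unimodular_ratio_gt0 x y : 0 <= x -> x < 1 -> 0 <= y -> y < 1 ->
  0 < p.[y] / p.[x].
Proof.
wlog xy : x y / x <= y.
  move=> H x0 x1 y0 y1; have [xy|/ltW yx] := leP x y; first exact: H.
  by rewrite -invr_gt0 invf_div; apply: H.
move=> x0 x1 y0 y1; rewrite lt_neqAle eq_sym mulf_neq0 ?invr_neq0 ?unimodular_neq0//=.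
rewrite leNgt; apply/negP => neg.
(* Intermediate value theorem for [p] or [- p]: a change of sign would give a root of modulus less
   than 1. *)
have cont q : q.[x] <= 0 <= q.[y] -> (q == p) || (q == - p) -> False.
  move=> /(poly_ivt xy)[z /andP[xz zy]] rz /orP qp.
  have /eqP := @unimodular_neq0 z (le_trans x0 xz) (le_lt_trans zy y1); apply.
  by case: qp rz => /eqP->; rewrite rootE ?hornerN ?oppr_eq0 => /eqP.
have [px|px] := leP p.[x] 0.
  apply: (cont p); last by rewrite eqxx.
  rewrite px leNgt; apply/negP => py; move: neg; rewrite ltNge => /negP; apply.
  by rewrite mulr_le0// ?invr_le0// ltW.
apply: (cont (- p)); last by rewrite eqxx orbT.
rewrite !hornerN oppr_le0 (ltW px) oppr_ge0 leNgt; apply/negP => py.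
move: neg; rewrite ltNge => /negP; apply.
by rewrite mulr_ge0// ?invr_ge0// ltW.
Qed.

(** Logarithmic derivative of the factorisation, by induction on the list of roots. *)
Lemma deriv_unimodular x : 0 <= x -> x < 1 ->
  ofR p^`().[x] = - ofR p.[x] * \sum_(u <- rs) (u - ofR x)^-1.
Proof.
move=> x0 x1; rewrite -horner_ofR -deriv_map horner_unimodular hp.1.
have : forall u, u \in rs -> u - ofR x != 0.
  by move=> u urs; rewrite sub_unit_neq0 ?rs1.
elim: (rs) => [|u s IH] h; first by rewrite !big_nil derivC horner0 mulr0.
rewrite !big_cons derivM hornerD !hornerM IH; last first.
  by move=> v vs; apply: h; rewrite inE vs orbT.
rewrite derivXsubC hornerC hornerXsubC mul1r.
rewrite horner_prod (eq_bigr (fun v => ofR x - v)); last first.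
  by move=> v _; rewrite hornerXsubC.
have : u - ofR x != 0 by apply: h; rewrite mem_head.
by move=> ux; field.
Qed.

(** The sum is minus the logarithmic derivative of a real polynomial. *)
Lemma sum_inv_real x : 0 <= x -> x < 1 ->
  \sum_(u <- rs) (u - ofR x)^-1 = ofR (- p^`().[x] / p.[x]).
Proof.
move=> x0 x1; have px : ofR p.[x] != 0.
  by rewrite fmorph_eq0 unimodular_neq0.
rewrite rmorphM rmorphN fmorphV /= deriv_unimodular//.
by field.
Qed.

Lemma cauchy_meanE x : 0 <= x -> x < 1 ->
  cauchy_mean rs x = (size rs)%:R^-1 * (- p^`().[x] / p.[x]).
Proof.
by move=> x0 x1; rewrite /cauchy_mean -Re_sum sum_inv_real.
Qed.

Lemma sum_Im_inv x : 0 <= x -> x < 1 ->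
  \sum_(u <- rs) complex.Im (u - ofR x)^-1 = 0.
Proof. by move=> x0 x1; rewrite -Im_sum sum_inv_real. Qed.

Lemma norm_cauchy_mean_le x : 0 <= x -> x < 1 ->
  `|cauchy_mean rs x| <= (1 - x)^-1.
Proof.
move=> x0 x1; apply: norm_mean_le => [|u urs].
  by rewrite invr_ge0 subr_ge0 ltW.
by rewrite (le_trans (Re_le_Cmod _))// Cmod_inv_sub_unit// rs1.
Qed.

(** Resolvent identity 1/(u-y) - 1/(u-x) = (y-x) / ((u-x)(u-y)), averaged over the roots. *)
Lemma dist_cauchy_mean_le x y : 0 <= x -> x < 1 -> 0 <= y -> y < 1 ->
  `|cauchy_mean rs y - cauchy_mean rs x| <= `|y - x| * ((1 - x)^-1 * (1 - y)^-1).
Proof.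
move=> x0 x1 y0 y1; rewrite /cauchy_mean -mulrBr -sumrB.
apply: norm_mean_le => [|u urs].
  by rewrite !mulr_ge0// invr_ge0 subr_ge0 ltW.
have -> : complex.Re (u - ofR y)^-1 - complex.Re (u - ofR x)^-1
        = complex.Re (ofR (y - x) * ((u - ofR x)^-1 * (u - ofR y)^-1)).
  rewrite -ReN -ReD rmorphB; congr complex.Re; field.
  by rewrite !sub_unit_neq0 ?rs1.
rewrite (le_trans (Re_le_Cmod _))// 2!CmodM CmodR ler_wpM2l// ler_pM ?Cmod_ge0//.
  by rewrite Cmod_inv_sub_unit ?rs1.
by rewrite Cmod_inv_sub_unit ?rs1.
Qed.

(* Each factor of p(y) / p(x) is 1 - (y - x) w with w = 1 / (u - x), and
   |1 - c w|^2 = 1 - 2 c Re w + c^2 |w|^2 <= exp (- 2 c Re w + c^2 |w|^2). *)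
Lemma unimodular_ratio_le x y : 0 <= x -> x < 1 -> 0 <= y -> y < 1 ->
  p.[y] / p.[x] <= expR ((size rs)%:R *
    (- (y - x) * cauchy_mean rs x + (y - x) ^+ 2 * (1 - x)^-1 ^+ 2 / 2)).
Proof.
move=> x0 x1 y0 y1; set c := y - x; set K := (1 - x)^-1.
(* Without roots [p] is 1; the final computation cancels [size rs] and needs it nonzero. *)
have [s0|s0] := eqVneq (size rs) 0%N.
  rewrite s0 mul0r expR0; move: hp.1; rewrite (size0nil s0) big_nil => /polyP pE.
  have -> : p = 1.
    apply/polyP => i; apply: ofR_inj.
    by have := pE i; rewrite coef_map /= => ->; rewrite !coef1 rmorph_nat.
  by rewrite !hornerC divr1.
(* The ratio is positive, hence equal to its modulus, which factors over the complex roots. *)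
rewrite -[leLHS](ger0_norm (ltW (unimodular_ratio_gt0 x0 x1 y0 y1))).
have -> : `|p.[y] / p.[x]| = \prod_(u <- rs) Cmod (1 - ofR c * (u - ofR x)^-1).
  rewrite -CmodR rmorphM fmorphV /= !horner_unimodular.
  rewrite -prodfV -big_split /= big_seq [RHS]big_seq.
  rewrite (big_morph (@Cmod R) (@CmodM R) (@Cmod1 R)).
  apply: eq_bigr => u urs; congr Cmod; rewrite /c rmorphB; field.
  by rewrite sub_unit_neq0 ?rs1// -oppr_eq0 opprB sub_unit_neq0 ?rs1.
have fac u : u \in rs -> Cmod (1 - ofR c * (u - ofR x)^-1) <=
    expR (- c * complex.Re (u - ofR x)^-1 + c ^+ 2 * K ^+ 2 / 2).
  move=> urs; set w := (u - ofR x)^-1.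
  rewrite -(@ler_pXn2r _ 2)// ?nnegrE ?Cmod_ge0 ?expR_ge0//.
  rewrite -expRM_natl mulrDr.
  have wK : Cmod w ^+ 2 <= K ^+ 2.
    have K0 : 0 <= K by rewrite invr_ge0 subr_ge0 ltW.
    rewrite ler_pXn2r ?nnegrE ?Cmod_ge0//.
    by rewrite Cmod_inv_sub_unit ?rs1.
  have -> : Cmod (1 - ofR c * w) ^+ 2 = 1 + (2 * (- c * complex.Re w) + c ^+ 2 * Cmod w ^+ 2).
    rewrite !Cmod_sqr ReD ImD ReN ImN ReZ ImZ /=; ring.
  apply: le_trans (expR_ge1Dx _); rewrite lerD2l lerD2l.
  have -> : 2 * (c ^+ 2 * K ^+ 2 / 2) = c ^+ 2 * K ^+ 2 by field.
  by rewrite ler_wpM2l ?sqr_ge0.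
apply: (@le_trans _ _ (\prod_(u <- rs)
    expR (- c * complex.Re (u - ofR x)^-1 + c ^+ 2 * K ^+ 2 / 2))).
  rewrite big_seq [leRHS]big_seq ler_prod// => u urs.
  by rewrite Cmod_ge0 fac.
rewrite -(big_morph (@expR R) (@expRD R) (@expR0 R)) ler_expR.
rewrite big_split /= -mulr_sumr big_const_seq count_predT iter_addr_0 /cauchy_mean.
rewrite le_eqVlt -[X in _ + X]mulr_natl; apply/orP; left; apply/eqP.
by field; rewrite pnatr_eq0.
Qed.

End UnimodularRoots.

(** * The approximate fixed point equation *)

Definition herm_zeros (R : realType) (a : R) (n : nat) : seq (C R) :=
  sval (closed_field_poly_normal (herm (ofR a) n)).

Lemma herm_zerosE (R : realType) (a : R) n :
  herm (ofR a) n = \prod_(u <- herm_zeros a n) ('X - u%:P).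
Proof.
rewrite /herm_zeros; case: closed_field_poly_normal => rs /= {1}->.
by rewrite (monicP (monic_herm _ _)) scale1r.
Qed.

Lemma size_herm_zeros (R : realType) (a : R) n : size (herm_zeros a n) = n.
Proof.
by have := size_herm (ofR a) n; rewrite herm_zerosE size_prod_XsubC => -[].
Qed.

Lemma herm_zeros_unit (R : realType) (a : R) n u : 0 < a -> a <= 1 ->
  u \in herm_zeros a n -> `|u| = 1.
Proof.
move=> a0 a1 un; apply: (@Lee_Yang _ (ofR a) n).
- by rewrite -(rmorph0 (@ofR R)) ltr_ofR.
- by rewrite -(rmorph1 (@ofR R)) ler_ofR.
- by rewrite herm_zerosE root_prod_XsubC.
Qed.

Lemma herm_unimodular (R : realType) (a : R) n : 0 < a -> a <= 1 ->
  unimodular_roots (herm a n) (herm_zeros a n).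
Proof.
move=> a0 a1; split => [|u]; last exact: herm_zeros_unit.
by rewrite map_herm herm_zerosE.
Qed.

(** This is [herm_qdiff] divided by (n+1) H(z), since h = -H' / ((n+1) H); the t_n of the overview
    is z h(z). *)
Lemma herm_cauchy_mean_eq (R : realType) (a : R) n z : 0 < a -> a <= 1 ->
  0 <= z -> z / a ^+ 2 < 1 ->
  let h := cauchy_mean (herm_zeros a n.+1) in
  let p := herm a n.+1 in
  h z = a ^+ n * (p.[z / a ^+ 2] / p.[z]) * (1 + z / a ^+ 2 * h (z / a ^+ 2)).
Proof.
move=> a0 a1 z0 bz1 h p; set y := z / a ^+ 2.
have y0 : 0 <= y by rewrite divr_ge0 ?exprn_ge0// ltW.
have z1 : z < 1.
  apply: le_lt_trans bz1; rewrite ler_pdivlMr ?exprn_gt0// ler_piMr//.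
  by rewrite expr_le1// ltW.
have un := herm_unimodular n.+1 a0 a1.
have pz := unimodular_neq0 un z0 z1.
have py := unimodular_neq0 un y0 bz1.
rewrite /h !(cauchy_meanE un)// size_herm_zeros herm_qdiff ?gt_eqF// -/y -/p.
by field; rewrite pz py addrC natr1 pnatr_eq0.
Qed.

Definition herm_param (R : realType) (sigma2 : R) (n : nat) : R :=
  expR (- (sigma2 / n%:R / 2)).

(* For h the Cauchy mean of the zeros of H at z and b = exp s, v bounds
   |ln (H(b z) / H(z)) + sigma2 z h|. *)
Definition limit_defect (R : realType) (sigma2 : R) (n : nat) : R :=
  let s := sigma2 / n%:R in
  let d := expR s - 1 in
  let v := 2 * `|sigma2 - n%:R * d| + 6 * (n%:R * d * d) in
  expR (2 * sigma2) * (2 * ((expR (s / 2 + v) - 1) + (1 - expR (- v))) + 4 * d).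

Lemma herm_param_itv (R : realType) (sigma2 : R) (n : nat) : 0 <= sigma2 ->
  0 < herm_param sigma2 n <= 1.
Proof.
by move=> s0; rewrite expR_gt0 expR_le1 oppr_le0 !mulr_ge0// invr_ge0.
Qed.

Lemma ler_norm_sandwich (R : realType) (x v w : R) :
  0 <= w -> 0 <= v -> expR (- v) <= x -> x <= expR w ->
  `|x - 1| <= (expR w - 1) + (1 - expR (- v)).
Proof.
move=> w0 v0 lx xu; rewrite ler_norml; apply/andP; split.
  have : 1 <= expR w by rewrite -expR0 ler_expR.
  by move=> ?; lra.
have : expR (- v) <= 1 by rewrite expR_le1 oppr_le0.
by move=> ?; lra.
Qed.

(** Quantitative form of the approximate equation. The bounds b <= 2 and z <= 1/4 give b z <= 1/2,
    which keeps the Cauchy means at z and at b z below 2 in modulus. *)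
Lemma herm_defect_le (R : realType) (sigma2 z : R) (n : nat) :
  0 < sigma2 -> (0 < n)%N -> expR (sigma2 / n%:R) <= 2 -> 0 < z -> z <= 4^-1 ->
  let h := cauchy_mean (herm_zeros (herm_param sigma2 n) n) z in
  `|h - expR (- sigma2 * (z * h + 2^-1)) * (1 + z * h)| <= limit_defect sigma2 n.
Proof.
case: n => // n s0 _ b2 z0 z4 /=; set N : R := n.+1%:R.
set a := herm_param sigma2 n.+1; set H := cauchy_mean _; set h := H z; rewrite /limit_defect.
have /andP[a0 a1] := herm_param_itv n.+1 (ltW s0).
set s := sigma2 / n.+1%:R in b2 *; set b := expR s in b2 *.
set d := b - 1; set v := (2 * _ + 6 * _).
have sp : 0 < s by rewrite divr_gt0.
have d0 : 0 <= d by rewrite subr_ge0 -expR0 ler_expR ltW.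
have v0 : 0 <= v by rewrite addr_ge0 ?mulr_ge0.
have aV : (a ^+ 2)^-1 = b.
  by rewrite /a /herm_param -/s -expRM_natl -expRN; congr expR; field.
have zb : z / a ^+ 2 = b * z by rewrite aV mulrC.
(* The power is one short of the degree n+1; the surplus exp(s/2) is the source of [s / 2] in
   [limit_defect]. *)
have an : a ^+ n = expR (- (sigma2 / 2)) * expR (s / 2).
  rewrite /a /herm_param -/s -expRM_natl -expRD; congr expR.
  by rewrite /s -[n.+1%:R]natr1; field; rewrite natr1.
have bz : b * z <= 2^-1 by nra.
have bz0 : 0 < b * z by rewrite mulr_gt0// expR_gt0.
have z1 : z < 1 by lra.
have bz1 : b * z < 1 by lra.
have un := herm_unimodular n.+1 a0 a1.
have := @herm_cauchy_mean_eq R a n z a0 a1 (ltW z0).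
rewrite zb => /(_ bz1) /=; rewrite -/H -/h; set k := H (b * z).
set rho := _.[_] / _ => hE.
have inv2 (x : R) : 0 <= x -> x <= 2^-1 -> 0 < (1 - x)^-1 <= 2.
  move=> x0 x2; rewrite invr_gt0 subr_gt0; apply/andP; split; first lra.
  by rewrite -[leRHS]invrK lef_pV2 ?posrE; lra.
have /andP[iz0 iz2] : 0 < (1 - z)^-1 <= 2 by apply: inv2; lra.
have /andP[ib0 ib2] : 0 < (1 - b * z)^-1 <= 2 by apply: inv2; lra.
have hle : `|h| <= 2 by rewrite (le_trans (norm_cauchy_mean_le un (ltW z0) z1)).
have kle : `|k| <= 2 by rewrite (le_trans (norm_cauchy_mean_le un (ltW bz0) bz1)).
have eta : b * z - z = d * z by rewrite /d; ring.
have dz0 : 0 <= d * z by rewrite mulr_ge0// ltW.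
have hk : `|k - h| <= 4 * d.
  rewrite (le_trans (dist_cauchy_mean_le un (ltW z0) z1 (ltW bz0) bz1))//.
  rewrite eta ger0_norm//.
  have /(ler_wpM2l dz0) /le_trans : (1 - z)^-1 * (1 - b * z)^-1 <= 4 by nra.
  by apply; rewrite mulrC ler_pM2l// ler_piMr// ltW.
have Np : 0 < N by rewrite ltr0n.
have rho0 : 0 < rho by apply: (unimodular_ratio_gt0 un) => //; exact: ltW.
(* The same one-sided estimate, used from z to b z and then from b z back to z, bounds the ratio
   from both sides. *)
have up : rho <= expR (N * (- (d * z) * h + 2 * (d * z) ^+ 2)).
  rewrite (le_trans (unimodular_ratio_le un (ltW z0) z1 (ltW bz0) bz1))//.
  rewrite ler_expR size_herm_zeros eta ler_pM2l// lerD2l.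
  have : 0 <= (d * z) ^+ 2 by rewrite sqr_ge0.
  have : (1 - z)^-1 ^+ 2 <= 4 by nra.
  by move=> ? ?; nra.
have lo : rho^-1 <= expR (N * (d * z * k + 2 * (d * z) ^+ 2)).
  rewrite invf_div (le_trans (unimodular_ratio_le un (ltW bz0) bz1 (ltW z0) z1))//.
  rewrite ler_expR size_herm_zeros -opprB eta ler_pM2l// opprK lerD2l sqrrN.
  have : 0 <= (d * z) ^+ 2 by rewrite sqr_ge0.
  have : (1 - b * z)^-1 ^+ 2 <= 4 by nra.
  by move=> ? ?; nra.
clearbody rho.
(* [K] is the ratio divided by its expected value; it is shown to lie between exp(-v) and exp(v). *)
set K := rho * expR (sigma2 * (z * h)).
have K0 : 0 < K by rewrite mulr_gt0// expR_gt0.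
have dz2 : N * (d * z) ^+ 2 <= N * d * d.
  rewrite -mulrA ler_pM2l// exprMn -expr2 ler_piMr ?sqr_ge0//.
  by rewrite expr_le1// ltW.
have zh : `|z * h| <= 2^-1.
  rewrite normrM (gtr0_norm z0).
  by have : z * `|h| <= 4^-1 * 2; [rewrite ler_pM// ltW | lra].
have zh1 : `|(sigma2 - N * d) * (z * h)| <= 2 * `|sigma2 - N * d|.
  rewrite normrM mulrC ler_wpM2r//; lra.
have Kup : K <= expR v.
  rewrite (le_trans (ler_wpM2r (expR_ge0 _) up))// -expRD ler_expR.
  have -> : N * (- (d * z) * h + 2 * (d * z) ^+ 2) + sigma2 * (z * h) =
    (sigma2 - N * d) * (z * h) + 2 * (N * (d * z) ^+ 2) by ring.
  move: zh1; rewrite ler_norml => /andP[_ zh1].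
  have : 0 <= N * d * d by rewrite !mulr_ge0// ltW.
  rewrite /v -/N; lra.
have Klo : expR (- v) <= K.
  rewrite -[K]invrK -[expR (- v)]invrK lef_pV2 ?posrE ?invr_gt0 ?expR_gt0//.
  rewrite -expRN opprK /K invfM -expRN.
  rewrite (le_trans (ler_wpM2r (expR_ge0 _) lo))// -expRD ler_expR.
  have -> : N * ((d * z) * k + 2 * (d * z) ^+ 2) + - (sigma2 * (z * h)) =
    - ((sigma2 - N * d) * (z * h)) + N * d * z * (k - h) + 2 * (N * (d * z) ^+ 2).
    by ring.
  move: zh1; rewrite ler_norml => /andP[zh1 _].
  (* The backward estimate involves [k] instead of [h]. Exchanging them costs 4 N d^2, which
     together with 2 N d^2 gives the coefficient 6 in [v]. *)
  have : N * d * z * (k - h) <= 4 * (N * d * d).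
    have -> : 4 * (N * d * d) = N * d * (4 * d) by ring.
    rewrite -mulrA ler_wpM2l ?mulr_ge0 ?(ltW Np)//.
    rewrite (le_trans (ler_norm _))// normrM (gtr0_norm z0).
    by rewrite (le_trans _ hk)// ler_piMl// ltW.
  rewrite /v -/N; lra.
clearbody v.
set c := expR (- (sigma2 / 2)).
have c1 : c <= 1 by rewrite expR_le1 oppr_le0 divr_ge0// ltW.
have c0 : 0 < c by exact: expR_gt0.
have EK : h = expR (- sigma2 * (z * h)) * (c * (expR (s / 2) * K) * (1 + b * z * k)).
  rewrite {1}hE an -/c /K mulNr expRN.
  by field; rewrite gt_eqF ?expR_gt0.
have -> : expR (- sigma2 * (z * h + 2^-1)) = expR (- sigma2 * (z * h)) * c.
  by rewrite -expRD; congr expR; field.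
rewrite [X in X - _]EK -[X in _ - X]mulrA -mulrBr normrM gtr0_norm ?expR_gt0//.
rewrite ler_pM ?expR_ge0//.
  rewrite ler_expR mulNr.
  have : `|sigma2 * (z * h)| <= sigma2 * 2^-1.
    by rewrite normrM (gtr0_norm s0) ler_pM2l.
  by rewrite ler_norml => /andP[]; nra.
(* Two errors: that of exp(s/2) K against 1, times a factor at most 2, and that of b z k against z
   h, whose two terms contribute 2 d each. *)
have -> : c * (expR (s / 2) * K) * (1 + b * z * k) - c * (1 + z * h) =
  c * ((expR (s / 2) * K - 1) * (1 + b * z * k) + (b * z * (k - h) + d * z * h)).
  by rewrite /d; ring.
rewrite normrM (gtr0_norm c0) (le_trans (ler_piMl _ c1))//.
have bk : `|1 + b * z * k| <= 2.
  rewrite (le_trans (ler_normD _ _))// normr1 normrM (gtr0_norm bz0).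
  by have : b * z * `|k| <= 2^-1 * 2; [rewrite ler_pM// ltW | lra].
have B1 : `|expR (s / 2) * K - 1| <= (expR (s / 2 + v) - 1) + (1 - expR (- v)).
  apply: ler_norm_sandwich => //; first by rewrite addr_ge0// divr_ge0// ltW.
    apply: (le_trans Klo); apply: ler_peMl; first exact: ltW.
    by rewrite -expR0 ler_expR divr_ge0// ltW.
  by rewrite expRD ler_pM2l ?expR_gt0.
rewrite (le_trans (ler_normD _ _))// lerD//.
  by rewrite normrM mulrC ler_pM.
rewrite (le_trans (ler_normD _ _))//.
have -> : 4 * d = 2 * d + 2 * d by ring.
rewrite lerD// normrM ?(gtr0_norm bz0) ?(ger0_norm dz0).
  by rewrite (le_trans (ler_pM (ltW bz0) (normr_ge0 _) bz hk))//; lra.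
rewrite mulrC ler_pM// ?normr_ge0//.
by rewrite ler_piMr// ltW.
Qed.

Lemma cvg_div_nat (R : realType) (c : R) : c / n%:R @[n --> \oo] --> (0 : R).
Proof.
rewrite -[X in _ --> X](mulr0 c); apply: cvgMr.
have : (n.+1%:R^-1 : R) @[n --> \oo] --> (0 : R) by exact: cvg_harmonic.
by move=> H; rewrite -cvg_shiftS.
Qed.

Lemma cvg_expR_div_nat (R : realType) (c : R) : expR (c / n%:R) @[n --> \oo] --> (1 : R).
Proof.
rewrite -[X in _ --> X]expR0.
by apply: continuous_cvg; [exact: continuous_expR|exact: cvg_div_nat].
Qed.

(** Squeeze between c and c exp(c/n), from x <= exp(x) - 1 <= x exp(x), valid for x of either
    sign. *)
Lemma cvg_nat_mul_expR_sub1 (R : realType) (c : R) :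
  n%:R * (expR (c / n%:R) - 1) @[n --> \oo] --> c.
Proof.
apply: (@squeeze_cvgr _ _ _ _ (fun=> c) (fun n => c * expR (c / n%:R))).
- near=> n; have n0 : 0 < n%:R :> R.
    by rewrite ltr0n; near: n; exact: nbhs_infty_gt.
  set x := c / n%:R; have cE : c = n%:R * x by rewrite /x mulrC divfK// gt_eqF.
  rewrite {1 2}cE -mulrA !ler_pM2l//; apply/andP; split.
    by have := expR_ge1Dx x; lra.
  have := expR_ge1Dx (- x); rewrite -(@ler_pM2r _ (expR x)) ?expR_gt0//.
  by rewrite -expRD addNr expR0; lra.
- exact: cvg_cst.
- rewrite -[X in _ --> X](mulr1 c); apply: cvgMr; exact: cvg_expR_div_nat.
Unshelve. all: by end_near. Qed.

Lemma limit_defect_cvg0 (R : realType) (sigma2 : R) :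
  limit_defect sigma2 n @[n --> \oo] --> (0 : R).
Proof.
have s0 := cvg_div_nat sigma2.
have d0 : expR (sigma2 / n%:R) - 1 @[n --> \oo] --> (0 : R).
  rewrite -[X in _ --> X](subrr 1); apply: cvgB; last exact: cvg_cst.
  exact: cvg_expR_div_nat.
have nd := @cvg_nat_mul_expR_sub1 R sigma2.
pose v (n : nat) : R := 2 * `|sigma2 - n%:R * (expR (sigma2 / n%:R) - 1)| +
  6 * (n%:R * (expR (sigma2 / n%:R) - 1) * (expR (sigma2 / n%:R) - 1)).
have v0 : v n @[n --> \oo] --> (0 : R).
  have -> : 0 = 2 * `|sigma2 - sigma2| + 6 * (sigma2 * 0) :> R.
    by rewrite subrr normr0 !mulr0 addr0.
  apply: cvgD; apply: cvgMr.
    by apply: cvg_norm; apply: cvgB => //; exact: cvg_cst.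
  exact: cvgM.
have ev (u : nat -> R) : u n @[n --> \oo] --> (0 : R) -> expR (u n) @[n --> \oo] --> (1 : R).
  by move=> u0; rewrite -[X in _ --> X]expR0; apply: continuous_cvg => //; exact: continuous_expR.
rewrite /limit_defect /=.
have -> : 0 = expR (2 * sigma2) * (2 * ((1 - 1) + (1 - 1)) + 4 * 0) :> R.
  by rewrite subrr addr0 !mulr0 addr0 mulr0.
apply: cvgMr; apply: cvgD; apply: cvgMr => //.
apply: cvgD; apply: cvgB; try exact: cvg_cst.
  apply: ev; rewrite -[X in _ --> X](addr0 0); apply: cvgD => //.
  by rewrite -[X in _ --> X](mul0r 2^-1); apply: cvgMl.
by apply: ev; rewrite -[X in _ --> X]oppr0; apply: cvgN.
Qed.

(** * The unit circle *)

(** Positive elements for the partial order of [C R] are real, so the radii in complex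
    neighbourhoods can be taken in [R]. *)
Lemma gt0_C (R : realType) (e : C R) : 0 < e -> exists2 r : R, 0 < r & e = ofR r.
Proof.
move=> e0; have eE : e = ofR (complex.Re e).
  by apply/esym; apply: (@RRe_real _ (e : R[i])); exact: gtr0_real.
exists (complex.Re e) => //.
by move: e0; rewrite {1}eE -(rmorph0 (@ofR R)) ltr_ofR.
Qed.

Lemma normC_lt (R : realType) (z : C R) (r : R) : (`|z| < ofR r) = (Cmod z < r).
Proof. by rewrite -ofR_Cmod ltr_ofR. Qed.

Lemma near_distC (R : realType) (z : C R) (r : R) : 0 < r ->
  \forall w \near z, `|z - w| < ofR r.
Proof.
move=> r0; apply/nbhs_normP; exists (ofR r) => //=.
by rewrite -(rmorph0 (@ofR R)) ltr_ofR.
Qed.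

Lemma continuous_ofR (R : realType) : continuous (@ofR R).
Proof.
move=> x; apply/cvgrPdist_lt => e /gt0_C[r r0 ->].
near=> y; rewrite -rmorphB normC_lt CmodR.
by near: y; apply: cvgr_dist_lt.
Unshelve. all: by end_near. Qed.

Lemma continuous_Re (R : realType) : continuous (@complex.Re R : C R -> R).
Proof.
move=> z; apply/(@cvgrPdist_lt _ _ _ _ (nbhs_filter z)) => r r0.
near=> w; rewrite -ReN -ReD (le_lt_trans (Re_le_Cmod _))// -normC_lt.
by near: w; exact: near_distC.
Unshelve. all: by end_near. Qed.

Lemma continuous_Im (R : realType) : continuous (@complex.Im R : C R -> R).
Proof.
move=> z; apply/(@cvgrPdist_lt _ _ _ _ (nbhs_filter z)) => r r0.
near=> w; rewrite -ImN -ImD (le_lt_trans (Im_le_Cmod _))// -normC_lt.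
by near: w; exact: near_distC.
Unshelve. all: by end_near. Qed.

Lemma continuous_val_circle (R : realType) : continuous (val : circle R -> C R).
Proof. exact: (@initial_continuous (circle R) (C R) val). Qed.

Lemma normr_val_circle (R : realType) (u : circle R) : `|val u| = 1.
Proof. by case: u => z zu; have := set_mem zu. Qed.

Lemma Cmod_val_circle (R : realType) (u : circle R) : Cmod (val u) = 1.
Proof. exact/Cmod_eq1/normr_val_circle. Qed.

(** * Parametrisation, compactness and uniform continuity *)

Definition cis (R : realType) (t : R) : C R := ofR (cos t) + 'i * ofR (sin t).

Lemma cisE (R : realType) (t : R) : cis t = Complex (cos t) (sin t).
Proof.
have iE : 'i = Complex 0 1 :> C R by [].
rewrite /cis iE; apply/eqP; rewrite eq_complex /=; apply/andP; split; apply/eqP; ring.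
Qed.

Lemma normr_cis (R : realType) (t : R) : `|cis t| = 1.
Proof.
rewrite -ofR_Cmod -(rmorph1 (@ofR R)); congr ofR.
apply/eqP; rewrite -(@eqrXn2 _ 2) ?Cmod_ge0// Cmod_sqr cisE /= cos2Dsin2.
by rewrite expr1n.
Qed.

Definition circle_cis (R : realType) (t : R) : circle R :=
  exist _ (cis t) (mem_set (normr_cis t)).

Lemma continuous_circle_cis (R : realType) : continuous (@circle_cis R).
Proof.
apply: (@continuous_comp_initial _ _ _ (val : circle R -> C R)) => t.
apply: cvgD; [|apply: cvgMr];
  apply: (@continuous_comp _ _ _ _ (@ofR R)); try exact: continuous_ofR.
- exact: continuous_cos.
- exact: continuous_sin.
Qed.

(** The angle is the arccosine of the real part, with the sign of the imaginary part. *)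
Lemma circle_cis_surj (R : realType) (u : circle R) :
  exists2 t, - pi <= t <= pi & circle_cis t = u.
Proof.
have := Cmod_sqr (val u); rewrite Cmod_val_circle expr1n.
set x := complex.Re _; set y := complex.Im _ => xy.
have x1 : -1 <= x <= 1.
  rewrite -ler_norml -(@ler_pXn2r _ 2)// ?nnegrE// expr1n real_normK ?num_real//.
  by rewrite xy lerDl sqr_ge0.
have sy : sin (acos x) = `|y|.
  by rewrite sin_acos// xy addrC addKr sqrtr_sqr.
have pi0 := pi_ge0 R.
have uE : val u = Complex x y by rewrite /x /y; case: (val u).
have [y0|y0] := leP 0 y.
  exists (acos x).
    by rewrite acos_lepi// andbT (le_trans _ (acos_ge0 x1))// oppr_le0.
  by apply: val_inj; rewrite /= cisE acosK ?in_itv// sy ger0_norm// -uE.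
exists (- acos x).
  by rewrite lerN2 acos_lepi//= (le_trans _ pi0)// oppr_le0 acos_ge0.
apply: val_inj; rewrite /= cisE cosN sinN acosK ?in_itv// sy ltr0_norm// opprK -uE//.
Qed.

Lemma compact_circle (R : realType) : compact [set: circle R].
Proof.
have -> : [set: circle R] = @circle_cis R @` `[- pi, pi].
  apply/seteqP; split => // u _; have [t tpi <-] := circle_cis_surj u.
  by exists t => //=; rewrite in_itv.
apply: continuous_compact; last exact: segment_compact.
exact/continuous_subspaceT/continuous_circle_cis.
Qed.

(** Heine-Cantor theorem, from the near-covering form of compactness with the radius [d] tending to
    0 from the right as filter variable. *)
Lemma continuous_circle_unif (R : realType) (f : circle R -> R) (e : R) :
  continuous f -> 0 < e -> exists2 d, 0 < d &
  forall u v, Cmod (val u - val v) < d -> `|f u - f v| < e.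
Proof.
move=> cf e0; have := @compact_circle R; rewrite compact_near_coveringP.
move=> /(_ R (at_right 0) (fun d u => forall v, Cmod (val u - val v) < d -> `|f u - f v| < e) _).
case=> [u _|].
  have e2 : 0 < e / 2 by rewrite divr_gt0.
  have := cf u; move=> /cvgrPdist_lt /(_ _ e2).
  rewrite -/(nbhs u _) => -[_ [[B oB <-] Bu sB]].
  have [r r0 Br] : exists2 r, 0 < r & forall z, Cmod (val u - z) < r -> B z.
    have : nbhs (val u) B by exact: open_nbhs_nbhs.
    move=> /nbhs_normP[e' /gt0_C[r r0 ->]] sub; exists r => // z zr.
    by apply: sub; rewrite /ball_ /= normC_lt.
  have r2 : 0 < r / 2 by rewrite divr_gt0.
  near=> v d => /= w vw.
  have uv : Cmod (val u - val v) < r / 2.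
    rewrite -normC_lt; near: v.
    have : \forall v \near val u, `|val u - v| < ofR (r / 2) by exact: near_distC.
    exact: (@continuous_val_circle R u).
  have dr : d < r / 2 by near: d; exact: nbhs_right_lt.
  have fu w' : Cmod (val u - val w') < r -> `|f u - f w'| < e / 2.
    by move=> h; apply: sB => /=; exact: Br.
  have h1 : `|f u - f v| < e / 2 by apply: fu; lra.
  have h2 : `|f u - f w| < e / 2.
    apply: fu; have := CmodD (val u - val v) (val v - val w).
    by rewrite addrA subrK; lra.
  have -> : f v - f w = (f u - f w) - (f u - f v) by ring.
  by rewrite (le_lt_trans (ler_normB _ _))//; lra.
move=> d [/= d0 H]; exists (d / 2); first by rewrite divr_gt0.
move=> u v uv; apply: (H (d / 2)) => //=.
- by rewrite sub0r normrN gtr0_norm ?divr_gt0//; lra.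
- by rewrite divr_gt0.
Unshelve. all: by end_near. Qed.

Lemma continuous_circle_bounded (R : realType) (f : circle R -> R) :
  continuous f -> exists2 M, 0 <= M & forall u, `|f u| <= M.
Proof.
move=> cf; have : compact (f @` [set: circle R]).
  by apply: continuous_compact (@compact_circle R); exact: continuous_subspaceT.
move=> /compact_bounded[M [_ MB]]; exists (`|M| + 1) => // u.
by apply: (MB (`|M| + 1)); [rewrite ltr_pwDr// ler_norm|exists u].
Qed.

(** * Integrals on the circle *)

Section ContinuousFun.
Variables (T : topologicalType) (K : numFieldType).
Implicit Types f g : T -> K.

Lemma continuous_cst_fun (k : K) : continuous (fun _ : T => k).
Proof. by move=> x; apply: (@cvg_cst _ _ _ _ (nbhs_filter x)). Qed.

Lemma continuous_addf f g : continuous f -> continuous g ->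
  continuous (fun x => f x + g x).
Proof.
by move=> cf cg x; apply: (@cvgD _ _ _ _ (nbhs_filter x)); [exact: cf|exact: cg].
Qed.

Lemma continuous_subf f g : continuous f -> continuous g ->
  continuous (fun x => f x - g x).
Proof.
by move=> cf cg x; apply: (@cvgB _ _ _ _ (nbhs_filter x)); [exact: cf|exact: cg].
Qed.

Lemma continuous_mulf f g : continuous f -> continuous g ->
  continuous (fun x => f x * g x).
Proof.
by move=> cf cg x; apply: (@cvgM _ _ _ (nbhs_filter x)); [exact: cf|exact: cg].
Qed.

Lemma continuous_invf f : continuous f -> (forall x, f x != 0) ->
  continuous (fun x => (f x)^-1).
Proof.
by move=> cf f0 x; apply: (@cvgV _ _ _ (nbhs_filter x)); [exact: f0|exact: cf].
Qed.

Lemma continuous_expf f n : continuous f -> continuous (fun x => f x ^+ n).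
Proof.
move=> cf; elim: n => [|n IH].
  by under eq_fun do rewrite expr0; exact: continuous_cst_fun.
by under eq_fun do rewrite exprS; exact: continuous_mulf.
Qed.

End ContinuousFun.

Lemma measurable_circle (R : realType) (f : circle R -> R) :
  continuous f -> measurable_fun [set: borel_circle R] (f : borel_circle R -> R).
Proof.
move=> /continuousP cf; apply: (measurability _ (RGenOpens.measurableE R)).
move=> _ [_ [a [b ->]] <-]; rewrite setTI.
by apply: sub_sigma_algebra; apply: cf; exact: interval_open.
Qed.

Section CircleIntegral.
Variables (R : realType) (mu : {measure set (borel_circle R) -> \bar R}).
Hypothesis mu_fin : (mu [set: borel_circle R] < +oo)%E.

Lemma integrable_circle (f : circle R -> R) : continuous f ->
  mu.-integrable [set: borel_circle R] (EFin \o (f : borel_circle R -> R)).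
Proof.
move=> cf; apply: measurable_bounded_integrable => //.
  exact: measurable_circle.
have [M M0 fM] := continuous_circle_bounded cf.
exists M; split; first exact: num_real.
by move=> x Mx u _; rewrite /= (le_trans (fM u))// ltW.
Qed.

Lemma circle_integralD (f g : circle R -> R) : continuous f -> continuous g ->
  \int[mu]_u (f u + g u) = \int[mu]_u f u + \int[mu]_u g u.
Proof. by move=> cf cg; apply: RintegralD => //; exact: integrable_circle. Qed.

Lemma circle_integralZ (a : R) (f : circle R -> R) : continuous f ->
  \int[mu]_u (a * f u) = a * \int[mu]_u f u.
Proof. by move=> cf; apply: RintegralZl => //; exact: integrable_circle. Qed.

Lemma circle_integral_le (f : circle R -> R) (M : R) : continuous f ->
  (forall u, `|f u| <= M) ->
  `|\int[mu]_u f u| <= M * fine (mu [set: borel_circle R]).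
Proof.
move=> cf fM.
have cn : continuous (fun u => `|f u|).
  by move=> u; apply: (@cvg_norm _ _ _ _ (nbhs_filter u)); exact: cf.
rewrite (le_trans (le_normr_Rintegral _ _))//; first exact: integrable_circle.
rewrite -Rintegral_cst//; apply: le_Rintegral => //; first exact: integrable_circle.
by apply: (@integrable_circle (fun=> M)); exact: continuous_cst_fun.
Qed.

End CircleIntegral.

(** The shape of [empirical_zeros] for an arbitrary list, with a normalisation [n] not tied to its
    length. *)
Definition empirical (R : realType) (n : nat) (s : seq (circle R)) :
    {measure set (borel_circle R) -> \bar R} :=
  mscale (n%:R^-1)%:nng
    (msum (fun i => \d_(nth (circle1 R) s i : borel_circle R)) (size s)).

Lemma empirical_setT (R : realType) (n : nat) (s : seq (circle R)) :
  empirical n s [set: borel_circle R] = (n%:R^-1 * (size s)%:R)%:E.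
Proof.
rewrite /= /mscale /= /msum (eq_bigr (fun=> 1%E)); last first.
  by move=> i _; exact: diracT.
by rewrite EFinM sumEFin sumr_const card_ord.
Qed.

Lemma empirical_fin (R : realType) (n : nat) (s : seq (circle R)) :
  (empirical n s [set: borel_circle R] < +oo)%E.
Proof. by rewrite empirical_setT ltry. Qed.

Lemma empirical_ge0_integral (R : realType) (n : nat) (s : seq (circle R))
    (f : circle R -> R) : continuous f -> (forall u, 0 <= f u) ->
  \int[empirical n s]_u f u = n%:R^-1 * \sum_(u <- s) f u.
Proof.
move=> cf f0; have mf : measurable_fun [set: borel_circle R] (EFin \o (f : borel_circle R -> R)).
  apply/measurable_EFinP. exact: measurable_circle.
rewrite /Rintegral ge0_integral_mscale//; last by move=> u _; rewrite lee_fin.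
rewrite ge0_integral_measure_sum//; last by move=> u _; rewrite lee_fin.
under eq_bigr do rewrite integral_dirac// diracT mul1e /=.
by rewrite sumEFin -EFinM /= (big_nth (circle1 R)) big_mkord.
Qed.

(** Adding a bound of |f| makes the integrand nonnegative; the constant is cancelled afterwards. *)
Lemma empirical_integral (R : realType) (n : nat) (s : seq (circle R))
    (f : circle R -> R) : continuous f ->
  \int[empirical n s]_u f u = n%:R^-1 * \sum_(u <- s) f u.
Proof.
move=> cf; have [M M0 fM] := continuous_circle_bounded cf.
have cM : continuous (fun _ : circle R => M) by exact: continuous_cst_fun.
have cfM : continuous (fun u => f u + M) by exact: continuous_addf.
have f0 u : 0 <= f u + M.
  by have := fM u; rewrite ler_norml => /andP[]; lra.
have := empirical_ge0_integral n s cfM f0.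
rewrite (circle_integralD (empirical_fin n s))// big_split mulrDr /=.
rewrite [X in _ + X = _ -> _](@empirical_ge0_integral _ n s (fun=> M))//.
by move/addIr.
Qed.

Lemma hermite_herm (R : realType) (sigma2 : R) (n : nat) :
  hermite n (sigma2 / n%:R) = herm (ofR (herm_param sigma2 n)) n.
Proof.
apply/polyP => j; rewrite coef_herm coef_poly ltnS.
case: leqP => jn; last by rewrite bin_small// mulr0 mul0r.
rewrite -rmorphXn /herm_param -expRM_natl natrM; congr (_ * ofR (expR _)).
by set s := sigma2 / _; field.
Qed.

(** [insub] succeeds on every root, so [pmap] discards nothing. *)
Lemma circle_zeros_val (R : realType) (p : {poly C R}) :
  (forall z, root p z -> `|z| = 1) -> p != 0 ->
  map val (circle_zeros p) = sval (closed_field_poly_normal p).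
Proof.
move=> hp p0; rewrite /circle_zeros; case: closed_field_poly_normal => rs /= pE.
have : forall z, z \in rs -> z \in [set z : C R | `|z| = 1].
  move=> z zrs; rewrite inE; apply: hp.
  by rewrite pE rootZ ?lead_coef_eq0// root_prod_XsubC.
elim: rs {pE} => //= z rs IH h.
rewrite insubT /=; first by apply: h; rewrite mem_head.
by move=> zz; rewrite IH// => w wrs; apply: h; rewrite inE wrs orbT.
Qed.

Definition herm_circle_zeros (R : realType) (sigma2 : R) (n : nat) :=
  circle_zeros (hermite n (sigma2 / n%:R)).

Lemma val_herm_circle_zeros (R : realType) (sigma2 : R) (n : nat) : 0 <= sigma2 ->
  map val (herm_circle_zeros sigma2 n) = herm_zeros (herm_param sigma2 n) n.
Proof.
move=> s0; rewrite /herm_circle_zeros hermite_herm circle_zeros_val//.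
  have /andP[a0 a1] := herm_param_itv n s0.
  by move=> z; apply: Lee_Yang; rewrite ?ler_ofR -?(rmorph0 (@ofR R)) -?(rmorph1 (@ofR R)) ?ler_ofR ?ltr_ofR.
by rewrite monic_neq0// monic_herm.
Qed.

Lemma empirical_zerosE (R : realType) (sigma2 : R) (n : nat) :
  empirical_zeros sigma2 n = empirical n (herm_circle_zeros sigma2 n).
Proof. by []. Qed.

Lemma size_herm_circle_zeros (R : realType) (sigma2 : R) (n : nat) : 0 <= sigma2 ->
  size (herm_circle_zeros sigma2 n) = n.
Proof. by move=> s0; rewrite -(size_map val) val_herm_circle_zeros// size_herm_zeros. Qed.

(** * Test functions *)

Section TestFunctions.
Variables (R : realType) (mu : nat -> {measure set (borel_circle R) -> \bar R}).
Variable nu : {measure set (borel_circle R) -> \bar R}.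
Hypothesis mu_le1 : forall n, (mu n [set: borel_circle R] <= 1)%E.
Hypothesis nu_le1 : (nu [set: borel_circle R] <= 1)%E.

Let mu_fin n : (mu n [set: borel_circle R] < +oo)%E.
Proof. exact: le_lt_trans (mu_le1 n) (ltry 1). Qed.

Let nu_fin : (nu [set: borel_circle R] < +oo)%E.
Proof. exact: le_lt_trans nu_le1 (ltry 1). Qed.

(** Continuity is bundled in because it supplies the integrability behind linearity of the
    integrals. *)
Definition cvg_test (f : circle R -> R) : Prop :=
  continuous f /\ \int[mu n]_u f u @[n --> \oo] --> \int[nu]_u f u.

Lemma cvg_test_ext f g : f =1 g -> cvg_test f -> cvg_test g.
Proof. by move=> /funext ->. Qed.

Lemma cvg_testD f g : cvg_test f -> cvg_test g -> cvg_test (fun u => f u + g u).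
Proof.
move=> [cf lf] [cg lg]; split; first exact: continuous_addf.
rewrite (circle_integralD nu_fin)//.
under eq_fun do rewrite (circle_integralD (mu_fin _))//.
exact: cvgD.
Qed.

Lemma cvg_testZ a f : cvg_test f -> cvg_test (fun u => a * f u).
Proof.
move=> [cf lf]; split.
  by apply: continuous_mulf => //; exact: continuous_cst_fun.
rewrite (circle_integralZ nu_fin)//.
under eq_fun do rewrite (circle_integralZ (mu_fin _))//.
exact: cvgMr.
Qed.

Lemma cvg_test0 : cvg_test (fun=> 0).
Proof.
split; first exact: continuous_cst_fun.
rewrite Rintegral_cst// mul0r.
under eq_fun do rewrite Rintegral_cst// mul0r.
exact: cvg_cst.
Qed.

Lemma cvg_test_sum (I : Type) (s : seq I) (F : I -> circle R -> R) :
  (forall i, cvg_test (F i)) -> cvg_test (fun u => \sum_(i <- s) F i u).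
Proof.
move=> hF; elim: s => [|i s IH].
  by under eq_fun do rewrite big_nil; exact: cvg_test0.
by under eq_fun do rewrite big_cons; exact: cvg_testD.
Qed.

Lemma circle_integral_dist (m : {measure set (borel_circle R) -> \bar R}) f g e :
  (m [set: borel_circle R] <= 1)%E -> continuous f -> continuous g ->
  (forall u, `|f u - g u| <= e) ->
  `|\int[m]_u f u - \int[m]_u g u| <= e.
Proof.
move=> m1 cf cg fg.
have mfin : (m [set: borel_circle R] < +oo)%E := le_lt_trans m1 (ltry 1).
have cg' : continuous (fun u => -1 * g u).
  by apply: continuous_mulf => //; exact: continuous_cst_fun.
have -> : \int[m]_u f u - \int[m]_u g u = \int[m]_u (f u + -1 * g u).
  by rewrite (circle_integralD mfin)// (circle_integralZ mfin)// mulN1r.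
have e0 : 0 <= e by rewrite (le_trans _ (fg (circle1 R))).
have := @circle_integral_le _ _ mfin (fun u => f u + -1 * g u) e.
move=> /(_ _ _)/le_trans; apply.
- exact: continuous_addf.
- by move=> u; rewrite mulN1r.
- rewrite ler_piMr// -lee_fin fineK//.
  by rewrite ge0_fin_numE.
Qed.

Lemma cvg_test_unif f : continuous f ->
  (forall e, 0 < e -> exists2 g, cvg_test g & forall u, `|f u - g u| <= e) ->
  cvg_test f.
Proof.
move=> cf H; split=> //; apply/cvgrPdist_lt => e e0.
have e4 : 0 < e / 4 by rewrite divr_gt0.
have [g [cg lg] fg] := H _ e4.
near=> n.
have h1 := circle_integral_dist nu_le1 cf cg fg.
have h2 := circle_integral_dist (mu_le1 n) cf cg fg.
have h3 : `|\int[nu]_u g u - \int[mu n]_u g u| < e / 4.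
  by near: n; exact: cvgr_dist_lt.
move: h1 h2 h3; set a := (\int[nu]_u f u); set b := (\int[mu n]_u f u).
set c := (\int[nu]_u g u); set d := (\int[mu n]_u g u) => h1 h2 h3.
have -> : a - b = (a - c) + (c - d) - (b - d) by ring.
rewrite (le_lt_trans (ler_normB _ _))//.
have := ler_normD (a - c) (c - d); lra.
Unshelve. all: by end_near. Qed.

(* The k-th coefficient of a generating function is the uniform limit, as z
   tends to 0, of its k-th truncated remainder divided by z ^ k. *)
Lemma cvg_test_coef (r : R) (G : R -> circle R -> R) (g : nat -> circle R -> R) :
  0 < r -> (forall k, continuous (g k)) ->
  (forall z, 0 < z -> z < r -> cvg_test (G z)) ->
  (forall z k u, 0 < z -> z < r ->
    `|G z u - \sum_(l < k) z ^+ l.+1 * g l u| <= 2 * z ^+ k.+1) ->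
  forall k, cvg_test (g k).
Proof.
move=> r0 cg hG hGg; elim/ltn_ind => k IH.
apply: cvg_test_unif => // e e0.
(* The remainder 2 z^(k+2), divided by z^(k+1), is 2 z, hence at most e. *)
pose z := Num.min (r / 2) (e / 2).
have z0 : 0 < z by rewrite lt_min !divr_gt0.
have zr : z < r by rewrite gt_min; apply/orP; left; lra.
have ze : 2 * z <= e.
  have : z <= e / 2 by rewrite ge_min lexx orbT.
  lra.
exists (fun u => z ^- k.+1 * (G z u + -1 * \sum_(l < k) z ^+ l.+1 * g l u)).
  apply/cvg_testZ/cvg_testD; first exact: hG.
  apply: cvg_testZ; apply: cvg_test_sum => l; apply: cvg_testZ.
  exact: IH.
move=> u; apply: le_trans ze.
have zk : 0 < z ^+ k.+1 by rewrite exprn_gt0.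
have := hGg z k.+1 u z0 zr; rewrite big_ord_recr /=.
set S := \sum_(l < k) _; rewrite [z ^+ k.+2]exprS.
rewrite mulrA [2 * z * _]mulrC -ler_pdivrMl//; apply: le_trans.
rewrite -[X in X * `|_|](gtr0_norm (_ : 0 < z ^- k.+1)) ?invr_gt0//.
rewrite -normrM -normrN le_eqVlt; apply/orP; left; apply/eqP; congr (`|_|).
by field; rewrite gt_eqF.
Qed.

(** The remainder of the geometric series is v^(k+1) / (1 - v) with v = u z, and |1 - v| >= 1/2. *)
Lemma circle_geometric_remainder (z : R) k (u : circle R) : 0 < z -> z < 2^-1 ->
  Cmod (val u * ofR z / (1 - val u * ofR z) -
        \sum_(l < k) ofR (z ^+ l.+1) * val u ^+ l.+1) <= 2 * z ^+ k.+1.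
Proof.
move=> z0 z2; set v := val u * ofR z.
have vz : Cmod v = z by rewrite CmodM Cmod_val_circle CmodR mul1r gtr0_norm.
have v1 : 2^-1 <= Cmod (1 - v).
  by have := CmodD (1 - v) v; rewrite subrK Cmod1 vz; lra.
have v0 : 1 - v != 0.
  by apply/eqP => v0; move: v1; rewrite v0 Cmod0; lra.
have -> : v / (1 - v) - \sum_(l < k) ofR (z ^+ l.+1) * val u ^+ l.+1 = v ^+ k.+1 / (1 - v).
  rewrite (eq_bigr (fun l : 'I_k => v * v ^+ l)); last first.
    by move=> l _; rewrite -exprS exprMn rmorphXn mulrC.
  rewrite -mulr_sumr; have := subrX1 v k => E.
  apply: (mulIf v0); rewrite mulrBl !divfK// -mulrA exprS.
  have -> : (\sum_(i < k) v ^+ i) * (1 - v) = 1 - v ^+ k by rewrite mulrC -opprB mulNr -E opprB.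
  by ring.
rewrite CmodM CmodV CmodX vz mulrC ler_pM2r ?exprn_gt0//.
rewrite -[leRHS]invrK lef_pV2 ?posrE//; lra.
Qed.

Lemma continuous_monomial k : continuous (fun u : circle R => val u ^+ k : C R).
Proof. by apply: continuous_expf; exact: continuous_val_circle. Qed.

Lemma continuous_Re_fun (T : topologicalType) (f : T -> C R) :
  continuous f -> continuous (fun x => complex.Re (f x)).
Proof.
by move=> cf x; apply: (@continuous_comp _ _ _ f); [exact: cf|exact: continuous_Re].
Qed.

Lemma continuous_Im_fun (T : topologicalType) (f : T -> C R) :
  continuous f -> continuous (fun x => complex.Im (f x)).
Proof.
by move=> cf x; apply: (@continuous_comp _ _ _ f); [exact: cf|exact: continuous_Im].
Qed.

(** The psi-integrand generates the positive powers of u, so [cvg_test_coef] applies to its real and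
    imaginary parts; the power 0 is the total mass. The constant [c] recombines the two parts. *)
Lemma cvg_test_moments (r : R) : 0 < r -> cvg_test (fun=> 1) ->
  (forall z, 0 < z -> z < r ->
    cvg_test (fun u => complex.Re (val u * ofR z / (1 - val u * ofR z))) /\
    cvg_test (fun u => complex.Im (val u * ofR z / (1 - val u * ofR z)))) ->
  forall k (c : C R), cvg_test (fun u => complex.Re (c * val u ^+ k)).
Proof.
move=> r0 h1 hG k c.
have r2 : 0 < Num.min r 2^-1 by rewrite lt_min r0/= invr_gt0.
have ReIm : cvg_test (fun u => complex.Re (val u ^+ k)) /\
            cvg_test (fun u => complex.Im (val u ^+ k)).
  case: k => [|k].
    split; first exact: (cvg_test_ext _ h1).
    exact: (cvg_test_ext _ cvg_test0).
  split.
    apply: (@cvg_test_coef _ (fun z u => complex.Re (val u * ofR z / (1 - val u * ofR z)))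
      (fun k u => complex.Re (val u ^+ k.+1)) r2).
    - by move=> l; exact/continuous_Re_fun/continuous_monomial.
    - by move=> z z0; rewrite lt_min => /andP[zr _]; have [] := hG z z0 zr.
    - move=> z l u z0; rewrite lt_min => /andP[_ z2].
      rewrite (eq_bigr (fun i : 'I_l => complex.Re (ofR (z ^+ i.+1) * val u ^+ i.+1))).
        rewrite -Re_sum -ReN -ReD (le_trans (Re_le_Cmod _))//.
        exact: circle_geometric_remainder.
      by move=> i _; rewrite ReZ.
  apply: (@cvg_test_coef _ (fun z u => complex.Im (val u * ofR z / (1 - val u * ofR z)))
    (fun k u => complex.Im (val u ^+ k.+1)) r2).
  - by move=> l; exact/continuous_Im_fun/continuous_monomial.
  - by move=> z z0; rewrite lt_min => /andP[zr _]; have [] := hG z z0 zr.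
  - move=> z l u z0; rewrite lt_min => /andP[_ z2].
    rewrite (eq_bigr (fun i : 'I_l => complex.Im (ofR (z ^+ i.+1) * val u ^+ i.+1))).
      rewrite -Im_sum -ImN -ImD (le_trans (Im_le_Cmod _))//.
      exact: circle_geometric_remainder.
    by move=> i _; rewrite ImZ.
apply: (@cvg_test_ext (fun u => complex.Re c * complex.Re (val u ^+ k) +
                               - complex.Im c * complex.Im (val u ^+ k))).
  by move=> u; case: c (val u ^+ k) => [a b] [x y] /=; rewrite mulNr.
by apply: cvg_testD; apply: cvg_testZ; case: ReIm.
Qed.

End TestFunctions.

(** * A positive kernel on roots of unity *)

(** X^n - 1 is separable in characteristic 0, so it has n distinct roots. *)
Lemma primitive_root_exists (F : numClosedFieldType) n : (0 < n)%N ->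
  exists z : F, n.-primitive_root z.
Proof.
move=> n0; have [rs] := closed_field_poly_normal ('X^n - 1 : {poly F}).
rewrite (monicP _) ?monicXnsubC// scale1r => rsE.
have rs1 : all n.-unity_root rs.
  by apply/allP => z; rewrite -root_prod_XsubC -rsE.
have rsn : (n <= size rs)%N.
  by rewrite -ltnS -(size_prod_XsubC rs id) -rsE size_XnsubC.
have rsu : uniq rs.
  by rewrite -separable_prod_XsubC -rsE separable_Xn_sub_1// pnatr_eq0 -lt0n.
by have /hasP[z _ ?] := has_prim_root n0 rs1 rsu rsn; exists z.
Qed.

Lemma conjC_unit (F : numClosedFieldType) (v : F) : `|v| = 1 -> v * v^* = 1.
Proof. by move=> v1; rewrite -normCK v1 expr1n. Qed.

Lemma Re_conjC (R : realType) (z : C R) : complex.Re z^* = complex.Re z.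
Proof. by case: z. Qed.

Section Kernel.
Variable R : realType.

(** At v = exp(i t) this is (2 + 2 cos t)^N, the unnormalised de la Vallee Poussin kernel, peaked at
    v = 1. *)
Definition kern (N : nat) (v : C R) : R := Cmod (1 + v) ^+ (2 * N).

(** On the circle |1 + v|^2 is the conjugate of v times (1 + v)^2; the binomial theorem does the
    rest. *)
Lemma kernE N v : `|v| = 1 ->
  ofR (kern N v) = \sum_(j < (2 * N).+1) 'C(2 * N, j)%:R * (v^* ^+ N * v ^+ j).
Proof.
move=> v1; have vv := conjC_unit v1.
rewrite /kern exprM rmorphXn rmorphXn /= ofR_Cmod normCK rmorphD rmorph1.
have -> : (1 + v) * (1 + v^*) = v^* * (1 + v) ^+ 2.
  have -> : (1 + v) * (1 + v^*) = (v * v^* + v) * (1 + v^*) by rewrite vv.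
  have -> : (v * v^* + v) * (1 + v^*) = (v * v^* + v) + (v * v^*) * (v^* + 1) by ring.
  have -> : v^* * (1 + v) ^+ 2 = v^* + (v * v^*) * 2 + (v * v^*) * v by ring.
  by rewrite vv; ring.
rewrite exprMn -exprM exprDn mulr_sumr; apply: eq_bigr => j _.
by rewrite expr1n mul1r mulr_natl mulrnAr.
Qed.

(** The exponent [(j - N) + (N - j)] is |j - N| in truncated subtraction; negative frequencies are
    conjugated, which preserves the real part. *)
Lemma kern_Re N v : `|v| = 1 ->
  kern N v = \sum_(j < (2 * N).+1)
    'C(2 * N, j)%:R * complex.Re (v ^+ ((j - N) + (N - j))).
Proof.
move=> v1; have -> : kern N v = complex.Re (ofR (kern N v)) by [].
rewrite kernE// Re_sum; apply: eq_bigr => j _.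
rewrite -(rmorph_nat (@ofR R)) ReZ; congr (_ * _).
have [Nj|jN] := leqP N j.
  have -> : (N - j = 0)%N by lia.
  rewrite addn0 -{1}(subnK Nj) exprD mulrCA -exprMn [v^* * v]mulrC.
  by rewrite (conjC_unit v1) expr1n mulr1.
have -> : (j - N = 0)%N by lia.
rewrite add0n -{1}(subnK (ltnW jN)) exprD -mulrA -exprMn [v^* * v]mulrC.
by rewrite (conjC_unit v1) expr1n mulr1 -rmorphXn Re_conjC.
Qed.

(** From |1 - v|^2 + |1 + v|^2 = 4: the second moment of the kernel becomes a difference of two
    masses. *)
Lemma kern_dist N v : `|v| = 1 ->
  kern N v * Cmod (1 - v) ^+ 2 = 4 * kern N v - kern N.+1 v.
Proof.
move=> v1; rewrite /kern mulnS exprD.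
have : Cmod (1 - v) ^+ 2 + Cmod (1 + v) ^+ 2 = 4.
  have := Cmod_sqr v; rewrite (Cmod_eq1 v1) expr1n !Cmod_sqr.
  rewrite !ReD !ImD !ReN !ImN /=; set x := complex.Re v; set y := complex.Im v.
  move=> h; transitivity (2 + 2 * (x ^+ 2 + y ^+ 2)); first by ring.
  by rewrite -h; ring.
by move=> /(canRL (addrK _)) ->; ring.
Qed.

Variables (M : nat) (w : C R).
Hypotheses (M0 : (0 < M)%N) (wM : M.-primitive_root w).

Lemma normr_prim : `|w| = 1.
Proof.
apply/eqP; rewrite -(@pexpr_eq1 _ _ M)// -normrX.
by rewrite (prim_expr_order wM) normr1.
Qed.

(** Summing over the M-th roots of unity kills every frequency not divisible by M. Those of the
    kernel lie between -N and N with N < M, so only j = N survives. *)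
Lemma sum_kern N u : (N < M)%N -> `|u| = 1 ->
  \sum_(k < M) kern N (u * (w ^+ k)^*) = M%:R * 'C(2 * N, N)%:R.
Proof.
move=> NM u1; apply: ofR_inj.
have w1 := normr_prim; have ww := conjC_unit w1.
have uw k : `|u * (w ^+ k)^*| = 1.
  by rewrite normrM norm_conjC normrX u1 w1 expr1n mulr1.
rewrite rmorph_sum rmorphM !rmorph_nat /=.
under eq_bigr do rewrite kernE//.
rewrite exchange_big /=.
have inner j : (j < (2 * N).+1)%N -> \sum_(k < M)
   ('C(2 * N, j)%:R * ((u * (w ^+ k)^*)^* ^+ N * (u * (w ^+ k)^*) ^+ j) : C R) =
   if j == N then M%:R * 'C(2 * N, N)%:R else 0.
  move=> jN; pose th : C R := w ^+ N * w^* ^+ j.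
  have E k : (u * (w ^+ k)^*)^* ^+ N * (u * (w ^+ k)^*) ^+ j =
      (u^* ^+ N * u ^+ j) * th ^+ k.
    rewrite /th rmorphM /= conjCK !exprMn rmorphXn -!exprM.
    by rewrite mulrACA ![(k * _)%N]mulnC.
  under eq_bigr do rewrite E.
  rewrite -mulr_sumr -mulr_sumr; case: eqP => [jE|jN'].
    have -> : th = 1 by rewrite /th jE -exprMn ww expr1n.
    rewrite (eq_bigr (fun=> 1)); last by move=> i _; rewrite expr1n.
    rewrite sumr_const card_ord jE -exprMn mulrC [u^* * u]mulrC (conjC_unit u1).
    by rewrite expr1n mul1r.
  have th1 : th != 1.
    apply/eqP => /(congr1 (fun x => x * w ^+ j)).
    rewrite /th -mulrA -exprMn [w^* * w]mulrC ww expr1n mulr1 mul1r => /eqP.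
    rewrite (eq_prim_root_expr wM) => /eqP NjM; apply: jN'.
    have [jM|Mj] := ltnP j M; first by move: NjM; rewrite !modn_small.
    have jE : j = (j - M + M)%N by rewrite subnK.
    by move: NjM; rewrite jE modnDr !modn_small//; lia.
  have thM : th ^+ M = 1.
    rewrite /th exprMn -!exprM ![(_ * M)%N]mulnC !exprM -rmorphXn.
    by rewrite (prim_expr_order wM) rmorph1 !expr1n mul1r.
  have := subrX1 th M; rewrite thM subrr => /esym/eqP.
  by rewrite mulf_eq0 subr_eq0 (negPf th1) => /eqP ->; rewrite !mulr0.
rewrite (eq_bigr (fun j : 'I_(2 * N).+1 =>
  if (j : nat) == N then (M%:R * 'C(2 * N, N)%:R : C R) else 0)); last first.
  by move=> j _; rewrite inner.
have NN : (N < (2 * N).+1)%N by lia.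
rewrite (bigD1 (Ordinal NN))//= eqxx big1 ?addr0// => j.
by rewrite -val_eqE /= => /negPf ->.
Qed.

(** By [kern_dist] and [sum_kern] this is M (4 C(2N, N) - C(2N+2, N+1)), and the ratio of these
    central binomials is (4N+2)/(N+1). Summing [kern N.+1] requires N+1 < M. *)
Lemma sum_kern_dist N u : (N.+1 < M)%N -> `|u| = 1 ->
  \sum_(k < M) kern N (u * (w ^+ k)^*) * Cmod (u - w ^+ k) ^+ 2 =
  M%:R * 'C(2 * N, N)%:R * (2 / N.+1%:R).
Proof.
move=> NM u1; have w1 := normr_prim.
have uw k : `|u * (w ^+ k)^*| = 1.
  by rewrite normrM norm_conjC normrX u1 w1 expr1n mulr1.
rewrite (eq_bigr (fun k : 'I_M => 4 * kern N (u * (w ^+ k)^*)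
                                  - kern N.+1 (u * (w ^+ k)^*))); last first.
  move=> k _; rewrite -kern_dist//; congr (_ * _ ^+ 2).
  have -> : 1 - u * (w ^+ k)^* = (w ^+ k - u) * (w ^+ k)^*.
    by rewrite mulrBl conjC_unit// normrX w1 expr1n.
  rewrite CmodM (_ : Cmod (w ^+ k)^* = 1) ?mulr1 1?Cmod_distC//.
  by apply: Cmod_eq1; rewrite norm_conjC normrX w1 expr1n.
rewrite sumrB -mulr_sumr !sum_kern//; last by lia.
have -> : ('C(2 * N.+1, N.+1)%:R : R) = 'C(2 * N, N)%:R * ((4 * N%:R + 2) / N.+1%:R).
  apply: (@mulIf _ (N.+1%:R * N.+1%:R)); first by rewrite mulf_neq0// pnatr_eq0.
  have -> : 'C(2 * N, N)%:R * ((4 * N%:R + 2) / N.+1%:R) * (N.+1%:R * N.+1%:R) =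
     (N.+1%:R * (4 * N%:R + 2)) * 'C(2 * N, N)%:R :> R.
    by field; rewrite addrC natr1 pnatr_eq0.
  have f0 : (N`!%:R * N`!%:R : R) != 0 by rewrite mulf_neq0// pnatr_eq0 -lt0n fact_gt0.
  apply: (mulIf f0).
  have h1 : (2 * N.+1)`!%:R = 'C(2 * N.+1, N.+1)%:R * (N.+1`!%:R * N.+1`!%:R) :> R.
    have := @bin_fact (2 * N.+1) N.+1; have -> : (2 * N.+1 - N.+1 = N.+1)%N by lia.
    by move=> <-; [rewrite !natrM|lia].
  have h2 : (2 * N)`!%:R = 'C(2 * N, N)%:R * (N`!%:R * N`!%:R) :> R.
    have := @bin_fact (2 * N) N; have -> : (2 * N - N = N)%N by lia.
    by move=> <-; [rewrite !natrM|lia].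
  have h3 : (2 * N.+1)`!%:R = (2 * N%:R + 2) * (2 * N%:R + 1) * (2 * N)`!%:R :> R.
    have -> : (2 * N.+1 = (2 * N).+2)%N by lia.
    by rewrite !factS !natrM -!natr1 natrM; ring.
  move: h1; rewrite h3 h2 !factS !natrM -!natr1 => h1.
  by rewrite -[LHS]mulrA [X in _ * X]mulrACA -h1; ring.
have -> : N.+1%:R = N%:R + 1 :> R by rewrite natr1.
by field; rewrite natr1 pnatr_eq0.
Qed.

End Kernel.

(** Uniform continuity handles points closer than [d]; beyond [d] the oscillation 2 B is at most 2 B
    / d^2 times the squared distance. *)
Lemma continuous_circle_quad (R : realType) (f : circle R -> R) (e : R) :
  continuous f -> 0 < e -> exists2 K, 0 <= K &
  forall u v, `|f u - f v| <= e + K * Cmod (val u - val v) ^+ 2.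
Proof.
move=> cf e0; have [B B0 fB] := continuous_circle_bounded cf.
have [d d0 fd] := continuous_circle_unif cf e0.
have d2 : 0 < d ^+ 2 by rewrite exprn_gt0.
exists (2 * B / d ^+ 2); first by rewrite divr_ge0 ?mulr_ge0// ltW.
move=> u v; have [uv|uv] := ltP (Cmod (val u - val v)) d.
  rewrite (le_trans (ltW (fd u v uv)))// lerDl.
  by rewrite mulr_ge0 ?sqr_ge0// divr_ge0 ?mulr_ge0// ltW.
have : 2 * B <= 2 * B / d ^+ 2 * Cmod (val u - val v) ^+ 2.
  rewrite -[leLHS](divfK (lt0r_neq0 d2)) ler_wpM2l//.
    by rewrite divr_ge0 ?mulr_ge0// ltW.
  by rewrite ler_pXn2r// ?nnegrE ?Cmod_ge0// ltW.
by have := fB u; have := fB v; have := ler_normB (f u) (f v); lra.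
Qed.

(** * Korovkin approximation of continuous functions *)

Section Korovkin.
Variables (R : realType) (mu : nat -> {measure set (borel_circle R) -> \bar R}).
Variable nu : {measure set (borel_circle R) -> \bar R}.
Hypothesis mu_le1 : forall n, (mu n [set: borel_circle R] <= 1)%E.
Hypothesis nu_le1 : (nu [set: borel_circle R] <= 1)%E.
Hypothesis mono : forall k (c : C R), cvg_test mu nu (fun u => complex.Re (c * val u ^+ k)).

Lemma cvg_test_kern N (c : C R) : `|c| = 1 ->
  cvg_test mu nu (fun u => kern N (val u * c)).
Proof.
move=> c1; apply: (cvg_test_ext (f := fun u => \sum_(j < (2 * N).+1)
    'C(2 * N, j)%:R * complex.Re (c ^+ ((j - N) + (N - j)) * val u ^+ ((j - N) + (N - j))))).
  move=> u; rewrite kern_Re; last by rewrite normrM normr_val_circle c1 mulr1.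
  by apply: eq_bigr => j _; rewrite -exprMn [c * _]mulrC.
by apply: cvg_test_sum => // j; apply: cvg_testZ.
Qed.

(* Korovkin: the weights kern N (u x^* ) / D over the M-th roots of unity x are
   positive, sum to 1, and have second moment 2 / (N + 1) about u. *)
Lemma cvg_test_continuous f : continuous f -> cvg_test mu nu f.
Proof.
move=> cf; apply: cvg_test_unif => // e e0.
have e2 : 0 < e / 2 by rewrite divr_gt0.
have [K K0 fK] := continuous_circle_quad cf e2.
pose N := Num.bound (K * 2 / (e / 2)).
have NK : K * (2 / N.+1%:R) <= e / 2.
  rewrite mulrA ler_pdivrMr ?ltr0n// [leRHS]mulrC -ler_pdivrMr//.
  rewrite (le_trans (ltW (archi_boundP _)))// ?ler_nat//.
  by rewrite divr_ge0 ?mulr_ge0// ltW.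
have [w wM] := @primitive_root_exists (C R) N.+2 isT.
have w1 k : `|w ^+ k| = 1 by rewrite normrX (normr_prim _ wM)// expr1n.
pose x (k : nat) : circle R := exist _ (w ^+ k) (mem_set (w1 k)).
have wx k : w ^+ k = val (x k) by [].
pose D : R := N.+2%:R * 'C(2 * N, N)%:R.
have D0 : 0 < D by rewrite mulr_gt0// ltr0n// bin_gt0; lia.
exists (fun u => D^-1 * \sum_(k < N.+2) f (x k) * kern N (val u * (w ^+ k)^*)).
  apply: cvg_testZ => //; apply: cvg_test_sum => // k; apply: cvg_testZ => //.
  by apply: cvg_test_kern; rewrite norm_conjC.
move=> u; have u1 := normr_val_circle u.
have NN : (N < N.+2)%N by lia.
have S1 := sum_kern (ltn0Sn _) wM NN u1.
have S2 := sum_kern_dist (ltn0Sn _) wM (ltnSn _) u1.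
(* The weights sum to 1, so f(u) is itself an average with the same weights. *)
have -> : f u = D^-1 * \sum_(k < N.+2) f u * kern N (val u * (w ^+ k)^*).
  by rewrite -mulr_sumr S1 -/D mulrCA mulVf ?mulr1// gt_eqF.
rewrite -mulrBr -sumrB normrM gtr0_norm ?invr_gt0// ler_pdivrMl//.
rewrite (le_trans (ler_norm_sum _ _ _))//.
have kern0 v : 0 <= kern N v :> R by rewrite exprn_ge0// Cmod_ge0.
apply: (@le_trans _ _ (\sum_(k < N.+2) (e / 2 * kern N (val u * (w ^+ k)^*) +
    K * (kern N (val u * (w ^+ k)^*) * Cmod (val u - w ^+ k) ^+ 2)))).
  apply: ler_sum => k _; rewrite -mulrBl normrM (ger0_norm (kern0 _)).
  rewrite [kern N _ * Cmod _ ^+ 2]mulrC mulrA -mulrDl ler_wpM2r//; exact: fK.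
rewrite big_split /= -!mulr_sumr S1 S2 -/D.
have -> : e / 2 * D + K * (D * (2 / N.+1%:R)) = D * (e / 2 + K * (2 / N.+1%:R)) by ring.
rewrite ler_pM2l// [leRHS](_ : e = e / 2 + e / 2); first by rewrite lerD2l.
by field.
Qed.

End Korovkin.

(** * The exact fixed point equation *)

Lemma norm_sin_le (R : realType) (x : R) : `|sin x| <= `|x|.
Proof.
wlog x0 : x / 0 <= x.
  move=> H; have [/H//|x0] := leP 0 x.
  by rewrite -normrN -sinN -(normrN x); apply: H; rewrite oppr_ge0 ltW.
have [c _] := @MVT_segment R sin cos 0 x x0
  (fun y _ => is_derive_sin y) (continuous_subspaceT (@continuous_sin R)).
rewrite sin0 !subr0 => ->; rewrite normrM ler_piMl//.
exact: cos_max.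
Qed.

Lemma norm_cos_sub1_le (R : realType) (x : R) : `|cos x - 1| <= `|x|.
Proof.
wlog x0 : x / 0 <= x.
  move=> H; have [/H//|x0] := leP 0 x.
  by rewrite -cosN -(normrN x); apply: H; rewrite oppr_ge0 ltW.
have [c _] := @MVT_segment R cos (fun y => - sin y) 0 x x0
  (fun y _ => is_derive_cos y) (continuous_subspaceT (@continuous_cos R)).
rewrite cos0 subr0 => ->; rewrite normrM ler_piMl// normrN.
exact: sin_max.
Qed.

Lemma norm_expR_sub1_le (R : realType) (x : R) : `|expR x - 1| <= expR `|x| * `|x|.
Proof.
have e1 : 1 <= expR `|x| by rewrite -expR0 ler_expR.
have [x0|x0] := leP 0 x.
  rewrite ger0_norm ?subr_ge0; last by rewrite -expR0 ler_expR.
  rewrite (ger0_norm x0).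
  have := expR_ge1Dx (- x); rewrite -(@ler_pM2l _ (expR x)) ?expR_gt0//.
  by rewrite -expRD subrr expR0; lra.
rewrite ltr0_norm; last by rewrite subr_lt0 -expR0 ltr_expR.
rewrite (@le_trans _ _ `|x|) ?ler_peMl//.
by rewrite ltr0_norm//; have := expR_ge1Dx x; lra.
Qed.

Lemma CexpD (R : realType) (z w : C R) : Cexp (z + w) = Cexp z * Cexp w.
Proof.
rewrite /Cexp ReD ImD expRD cosD sinD; apply/eqP; rewrite eq_complex /=.
by apply/andP; split; apply/eqP; ring.
Qed.

Lemma Cexp_ofR (R : realType) (x : R) : Cexp (ofR x) = ofR (expR x).
Proof. by rewrite /Cexp /= cos0 sin0 mulr1 mulr0. Qed.

Lemma Cexp_sub1_le (R : realType) (z : C R) :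
  Cmod (Cexp z - 1) <= 3 * expR (Cmod z) * Cmod z.
Proof.
set a := complex.Re z; set b := complex.Im z.
(* The first summand gives the 2 in the constant 3 = 2 + 1, through the bounds on cos b - 1 and sin
   b; the second gives the 1. *)
have -> : Cexp z - 1 = ofR (expR a) * (ofR (cos b - 1) + 'i * ofR (sin b)) + ofR (expR a - 1).
  have iE : 'i = Complex 0 1 :> C R by [].
  rewrite /Cexp iE -/a -/b; apply/eqP; rewrite eq_complex /=.
  by apply/andP; split; apply/eqP; ring.
have ar := Re_le_Cmod z; have bi := Im_le_Cmod z; rewrite -/a -/b in ar bi.
have ea : expR a <= expR (Cmod z).
  by rewrite ler_expR (le_trans (ler_norm _)).
have h1 : Cmod (ofR (cos b - 1) + 'i * ofR (sin b)) <= 2 * Cmod z.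
  rewrite (le_trans (CmodD _ _))// CmodM !CmodR (_ : Cmod 'i = 1) ?mul1r.
    by have := norm_cos_sub1_le b; have := norm_sin_le b; lra.
  by apply: Cmod_eq1; exact: normCi.
have h2 : `|expR a - 1| <= expR (Cmod z) * Cmod z.
  by rewrite (le_trans (norm_expR_sub1_le _))// ler_pM ?expR_ge0// ler_expR.
rewrite (le_trans (CmodD _ _))// CmodM !CmodR ger0_norm ?expR_ge0//.
have h3 : expR a * Cmod (ofR (cos b - 1) + 'i * ofR (sin b)) <= expR (Cmod z) * (2 * Cmod z).
  by rewrite ler_pM ?expR_ge0 ?Cmod_ge0.
have -> : 3 * expR (Cmod z) * Cmod z = expR (Cmod z) * (2 * Cmod z) + expR (Cmod z) * Cmod z by ring.
exact: lerD.
Qed.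

(** The relation exp(sigma2 (w + 1/2)) = (1 + w) z / w, which is the S-transform condition at w =
    psi(z), reads w = z [fixpoint_map] w. *)
Definition fixpoint_map (R : realType) (sigma2 : R) (w : C R) : C R :=
  (1 + w) * Cexp (ofR (- sigma2) * (w + 2^-1)).

Definition fixpoint_lip (R : realType) (sigma2 : R) : R :=
  expR (sigma2 / 2) * (6 * expR (2 * sigma2) * sigma2 + 1).

Lemma fixpoint_map_ofR (R : realType) (sigma2 t : R) :
  fixpoint_map sigma2 (ofR t) = ofR ((1 + t) * expR (- sigma2 * (t + 2^-1))).
Proof.
rewrite /fixpoint_map; have -> : ofR (- sigma2) * (ofR t + 2^-1) = ofR (- sigma2 * (t + 2^-1)).
  by rewrite rmorphM rmorphD fmorphV rmorph_nat.
by rewrite Cexp_ofR rmorphM rmorphD rmorph1.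
Qed.

(** Factoring out the real exponential at [t] leaves (t - w) - (1 + w)(exp(sigma2 (t - w)) - 1).
    Since t >= -1 that exponential is at most exp(sigma2 / 2); the 6 is the bound 2 on |1 + w| times
    the 3 of [Cexp_sub1_le]. *)
Lemma fixpoint_map_lip (R : realType) (sigma2 t : R) (w : C R) : 0 <= sigma2 ->
  `|t| <= 1 -> Cmod w <= 1 ->
  Cmod (fixpoint_map sigma2 (ofR t) - fixpoint_map sigma2 w) <= fixpoint_lip sigma2 * Cmod (ofR t - w).
Proof.
move=> s0 t1 w1; set d := Cmod (ofR t - w).
have d0 : 0 <= d := Cmod_ge0 _.
have d2 : d <= 2 by rewrite (le_trans (CmodD _ _))// CmodN CmodR; lra.
have E : Cexp (ofR (- sigma2) * (w + 2^-1)) =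
    ofR (expR (- sigma2 * (t + 2^-1))) * Cexp (ofR sigma2 * (ofR t - w)).
  rewrite -Cexp_ofR -CexpD; congr Cexp.
  rewrite rmorphM rmorphD fmorphV rmorph_nat !rmorphN /=; ring.
have -> : fixpoint_map sigma2 (ofR t) - fixpoint_map sigma2 w =
   ofR (expR (- sigma2 * (t + 2^-1))) *
     ((ofR t - w) - (1 + w) * (Cexp (ofR sigma2 * (ofR t - w)) - 1)).
  by rewrite fixpoint_map_ofR /fixpoint_map E rmorphM rmorphD rmorph1 /=; ring.
rewrite CmodM CmodR ger0_norm ?expR_ge0// /fixpoint_lip -mulrA ler_pM ?expR_ge0 ?Cmod_ge0//.
  by rewrite ler_expR; move: t1; rewrite ler_norml => /andP[]; nra.
rewrite (le_trans (CmodD _ _))// CmodN CmodM -/d.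
have h1 : Cmod (1 + w) <= 2 by rewrite (le_trans (CmodD _ _))// Cmod1; lra.
have h2 := Cexp_sub1_le (ofR sigma2 * (ofR t - w)).
have sd : Cmod (ofR sigma2 * (ofR t - w)) = sigma2 * d.
  by rewrite CmodM CmodR ger0_norm.
rewrite sd in h2.
have h3 : expR (sigma2 * d) <= expR (2 * sigma2) by rewrite ler_expR mulrC ler_wpM2r.
have h4 : 3 * expR (sigma2 * d) * (sigma2 * d) <= 3 * expR (2 * sigma2) * (sigma2 * d).
  by rewrite ler_wpM2r ?mulr_ge0// ler_pM2l.
have h5 : Cmod (1 + w) * Cmod (Cexp (ofR sigma2 * (ofR t - w)) - 1) <=
    2 * (3 * expR (2 * sigma2) * (sigma2 * d)).
  by rewrite ler_pM ?Cmod_ge0// (le_trans h2).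
rewrite mulrDl mul1r addrC lerD2r (le_trans h5)//.
by rewrite le_eqVlt; apply/orP; left; apply/eqP; ring.
Qed.

(** Contraction of ratio 1/2: the distance d satisfies d <= e + d/2. *)
Lemma fixpoint_map_fixed_dist (R : realType) (sigma2 z t e : R) (w : C R) :
  0 <= sigma2 -> 0 < z -> z * fixpoint_lip sigma2 <= 2^-1 -> `|t| <= 1 -> Cmod w <= 1 ->
  w = ofR z * fixpoint_map sigma2 w ->
  `|t - z * ((1 + t) * expR (- sigma2 * (t + 2^-1)))| <= e ->
  Cmod (ofR t - w) <= 2 * e.
Proof.
move=> s0 z0 zL t1 w1 wE te; have := fixpoint_map_lip s0 t1 w1.
set d := Cmod (ofR t - w) => lip.
have d0 : 0 <= d := Cmod_ge0 _.
have : d <= e + z * (fixpoint_lip sigma2 * d).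
  rewrite {1}/d {1}wE.
  have -> : ofR t - ofR z * fixpoint_map sigma2 w =
    ofR (t - z * ((1 + t) * expR (- sigma2 * (t + 2^-1)))) +
    ofR z * (fixpoint_map sigma2 (ofR t) - fixpoint_map sigma2 w).
    by rewrite fixpoint_map_ofR rmorphB rmorphM /=; ring.
  rewrite (le_trans (CmodD _ _))// CmodM !CmodR (gtr0_norm z0) lerD//.
  by rewrite ler_pM2l.
have : z * (fixpoint_lip sigma2 * d) <= 2^-1 * d by rewrite mulrA ler_wpM2r.
lra.
Qed.

Lemma continuous_psi_integrand (R : realType) (z : R) : 0 < z -> z < 2^-1 ->
  continuous (fun u : circle R => val u * ofR z / (1 - val u * ofR z) : C R).
Proof.
move=> z0 z2.
have cz : continuous (fun u : circle R => val u * ofR z : C R).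
  by apply: continuous_mulf; [exact: continuous_val_circle|exact: continuous_cst_fun].
apply: continuous_mulf; first exact: cz.
apply: continuous_invf => [|u].
  by apply: continuous_subf; [exact: continuous_cst_fun|exact: cz].
apply/eqP => /(congr1 (@Cmod R)); rewrite Cmod0 => E.
have := CmodD (1 - val u * ofR z) (val u * ofR z).
by rewrite subrK Cmod1 E CmodM Cmod_val_circle CmodR gtr0_norm//; lra.
Qed.

Lemma Cmod_psi_integrand (R : realType) (z : R) (u : circle R) : 0 < z -> z < 2^-1 ->
  Cmod (val u * ofR z / (1 - val u * ofR z)) <= 2 * z.
Proof.
move=> z0 z2; have := circle_geometric_remainder 0 u z0 z2.
by rewrite big_ord0 subr0 expr1.
Qed.

Section NuSide.
Variables (R : realType) (nu : probability (borel_circle R) R).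

Let nu_fin : (nu [set: borel_circle R] < +oo)%E.
Proof. by rewrite probability_setT ltry. Qed.

(** Real and imaginary parts contribute 2 z each. The bound also brings psi(z) into the
    neighbourhood of 0 where the S-transform identity holds. *)
Lemma Cmod_psi_transform_le (z : R) : 0 < z -> z < 2^-1 ->
  Cmod (psi_transform nu (ofR z)) <= 4 * z.
Proof.
move=> z0 z2; rewrite (le_trans (Cmod_le_ReIm _))//=.
have bd (f : circle R -> R) : continuous f -> (forall u, `|f u| <= 2 * z) ->
    `|\int[nu]_u f u| <= 2 * z.
  move=> cf fz; have := circle_integral_le nu_fin cf fz.
  by rewrite [fine _](congr1 fine (probability_setT nu)) mulr1.
have c := continuous_psi_integrand z0 z2.
have -> : 4 * z = 2 * z + 2 * z by ring.
apply: lerD; apply: bd.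
- exact: continuous_Re_fun.
- by move=> u; rewrite (le_trans (Re_le_Cmod _))// Cmod_psi_integrand.
- exact: continuous_Im_fun.
- by move=> u; rewrite (le_trans (Im_le_Cmod _))// Cmod_psi_integrand.
Qed.

Lemma near_radius (P : set (C R)) : nbhs (0 : C R) P ->
  exists2 r : R, 0 < r & forall z, Cmod z < r -> P z.
Proof.
move=> /nbhs_normP[e /gt0_C[r r0 ->] sub]; exists r => // z zr.
by apply: sub; rewrite /ball_ /= sub0r normrN normC_lt.
Qed.

Lemma psi_transform_fixed (sigma2 : R) : free_unitary_normal sigma2 nu ->
  exists2 r : R, 0 < r & forall z : R, 0 < z -> z < r ->
    psi_transform nu (ofR z) = ofR z * fixpoint_map sigma2 (psi_transform nu (ofR z)).
Proof.
move=> [_ [g [_ g0 _ /near_radius[r1 r10 gpsi]]]] /near_radius[r2 r20 Sg].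
(* The bound |psi(z)| <= 4 z explains the quarter of [r2]. *)
exists (Num.min (Num.min r1 (r2 / 4)) 2^-1).
  by rewrite !lt_min r10 divr_gt0//= invr_gt0.
move=> z z0; rewrite !lt_min => /andP[/andP[zr1 zr2] z2].
set w := psi_transform nu (ofR z).
have wz : g w = ofR z by apply: gpsi; rewrite CmodR gtr0_norm.
(* The S-transform identity holds on a punctured neighbourhood only; psi(z) = 0 would give z = g(0)
   = 0. *)
have w0 : w != 0.
  apply/eqP => w0; move: wz; rewrite w0 g0 -(rmorph0 (@ofR R)) => /(@ofR_inj R).
  by move=> zE; rewrite -zE ltxx in z0.
have := Sg w; rewrite /= => /(_ _ w0); rewrite wz => E.
have {}E : Cexp (ofR sigma2 * (w + 2^-1)) = (1 + w) / w * ofR z.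
  by apply: E; have := Cmod_psi_transform_le z0 z2; rewrite -/w; lra.
have EN : Cexp (ofR sigma2 * (w + 2^-1)) * Cexp (ofR (- sigma2) * (w + 2^-1)) = 1.
  rewrite -CexpD rmorphN /= mulNr subrr -(rmorph0 (@ofR R)) Cexp_ofR expR0.
  by rewrite rmorph1.
rewrite -[LHS]mulr1 -[X in _ * X = _]EN E /fixpoint_map; field.
exact: w0.
Qed.

End NuSide.

(** * Convergence *)

(* On the unit circle u^-1 = u^*, so u z / (1 - u z) is the conjugate of
   z / (u - z) for real z. *)
Lemma psi_integrandE (R : realType) (u : circle R) (z : R) : 0 < z -> z < 1 ->
  val u * ofR z / (1 - val u * ofR z) = (ofR z * (val u - ofR z)^-1)^*.
Proof.
move=> z0 z1; move: (val u) (normr_val_circle u) => {u} u u1.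
have uu := conjC_unit u1.
have zr : (ofR z : C R)^* = ofR z by apply/CrealP; apply/complex_realP; exists z.
have uz : u - ofR z != 0 by rewrite sub_unit_neq0// ltW.
have uz' : u^* - ofR z != 0.
  by rewrite -{1}zr -rmorphB conjC_eq0.
have E : 1 - u * ofR z = u * (u^* - ofR z) by rewrite mulrBr uu.
have u0 : u != 0 by rewrite -normr_gt0 u1.
rewrite rmorphM fmorphV rmorphB /= zr E; field.
by rewrite uz' u0.
Qed.

Section Empirical.
Variables (R : realType) (sigma2 z : R) (n : nat).
Hypotheses (s0 : 0 < sigma2) (z0 : 0 < z) (z2 : z < 2^-1).

Let z1 : z < 1. Proof. by move: z2; lra. Qed.

Let h := cauchy_mean (herm_zeros (herm_param sigma2 n) n) z.

Lemma empirical_zeros_le1 :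
  (empirical_zeros sigma2 n [set: borel_circle R] <= 1)%E.
Proof.
rewrite empirical_zerosE empirical_setT size_herm_circle_zeros ?(ltW s0)// lee_fin.
(* For n = 0 there are no zeros and the measure is null, so the mass is bounded by 1 rather than
   equal to it. *)
have [->|n0] := eqVneq n 0%N; first by rewrite mulr0.
by rewrite mulVf// pnatr_eq0.
Qed.

Lemma empirical_psi_Re :
  \int[empirical_zeros sigma2 n]_u complex.Re (val u * ofR z / (1 - val u * ofR z))
  = z * h.
Proof.
rewrite empirical_zerosE empirical_integral; last first.
  exact/continuous_Re_fun/continuous_psi_integrand.
rewrite /h /cauchy_mean size_herm_zeros [RHS]mulrCA; congr (_ * _); rewrite mulr_sumr.
rewrite -val_herm_circle_zeros ?(ltW s0)// big_map; apply: eq_bigr => u _.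
by rewrite psi_integrandE// Re_conjC ReZ.
Qed.

Lemma empirical_psi_Im :
  \int[empirical_zeros sigma2 n]_u complex.Im (val u * ofR z / (1 - val u * ofR z))
  = 0.
Proof.
rewrite empirical_zerosE empirical_integral; last first.
  exact/continuous_Im_fun/continuous_psi_integrand.
have /andP[a0 a1] := herm_param_itv n (ltW s0).
rewrite (eq_bigr (fun u => - z * complex.Im (val u - ofR z)^-1)); last first.
  move=> u _; rewrite psi_integrandE// mulNr -ImZ.
  by case: (ofR z * _) => ? ?.
rewrite -mulr_sumr -(big_map val xpredT (fun u => complex.Im (u - ofR z)^-1)).
rewrite val_herm_circle_zeros ?(ltW s0)//.
by rewrite (sum_Im_inv (herm_unimodular n a0 a1) (ltW z0) z1) !mulr0.
Qed.

(** As z <= 1, multiplying [herm_defect_le] by z makes t = z h an approximate solution in the sense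
    of [fixpoint_map_fixed_dist]. *)
Lemma empirical_psi_dist (w : C R) : (0 < n)%N -> expR (sigma2 / n%:R) <= 2 ->
  z <= 4^-1 -> z * fixpoint_lip sigma2 <= 2^-1 -> Cmod w <= 1 ->
  w = ofR z * fixpoint_map sigma2 w ->
  Cmod (ofR (z * h) - w) <= 2 * limit_defect sigma2 n.
Proof.
have z1' := z1; have z0' := z0.
move=> n0 b2 z4 zL w1 wE; have /andP[a0 a1] := herm_param_itv n (ltW s0).
have hd := herm_defect_le s0 n0 b2 z0 z4; rewrite /= -/h in hd.
have h2 : `|h| <= 2.
  rewrite (le_trans (norm_cauchy_mean_le (herm_unimodular n a0 a1) (ltW z0) z1))//.
  by rewrite -[leRHS]invrK lef_pV2 ?posrE; lra.
apply: fixpoint_map_fixed_dist (ltW s0) z0 zL _ w1 wE _.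
  by rewrite normrM (gtr0_norm z0); nra.
rewrite -mulrBr normrM (gtr0_norm z0) mulrC [(1 + _) * _]mulrC.
by rewrite (le_trans _ hd)// ler_piMr// ltW.
Qed.

End Empirical.

Lemma cvg_of_norm_le (R : realType) (f d : nat -> R) (l : R) :
  (\forall n \near \oo, `|f n - l| <= d n) -> d n @[n --> \oo] --> (0 : R) ->
  f n @[n --> \oo] --> l.
Proof.
move=> fd d0; apply/cvgrPdist_lt => e e0; near=> n.
rewrite distrC (@le_lt_trans _ _ (d n))//; first by near: n.
rewrite (le_lt_trans (ler_norm _))// -normrN -sub0r.
by near: n; exact: cvgr_dist_lt.
Unshelve. all: by end_near. Qed.

Theorem theorem2p2 (R : realType) (sigma2 : R) (hsigma2 : 0 < sigma2)
    (nu : probability (borel_circle R) R) (hnu : free_unitary_normal sigma2 nu) :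
  weak_cvg (fun n : nat => empirical_zeros sigma2 n) nu.
Proof.
pose mu n := empirical_zeros sigma2 n.
have mu1 n : (mu n [set: borel_circle R] <= 1)%E by exact: empirical_zeros_le1.
have nu1 : (nu [set: borel_circle R] <= 1)%E by rewrite probability_setT.
have test1 : cvg_test mu nu (fun=> 1).
  split; first exact: continuous_cst_fun.
  rewrite Rintegral_cst// mul1r [fine _](congr1 fine (probability_setT nu)).
  apply: cvg_near_cst; near=> n.
  rewrite Rintegral_cst// mul1r /mu empirical_zerosE empirical_setT.
  rewrite size_herm_circle_zeros ?(ltW hsigma2)//= mulVf// pnatr_eq0 -lt0n.
  by near: n; exact: nbhs_infty_gt.
have [r1 r10 fixed] := psi_transform_fixed hnu.
have L0 : 0 < fixpoint_lip sigma2.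
  by rewrite mulr_gt0 ?expR_gt0// ltr_wpDl// !mulr_ge0 ?expR_ge0// ltW.
(* Below [r] the exact equation holds, [herm_defect_le] applies, and z times the Lipschitz constant
   is at most 1/2. *)
pose r := Num.min (Num.min r1 4^-1) (2^-1 / fixpoint_lip sigma2).
have r0 : 0 < r by rewrite !lt_min r10/= invr_gt0 divr_gt0 ?invr_gt0 ?andbT//.
suff mom : forall k (c : C R), cvg_test mu nu (fun u => complex.Re (c * val u ^+ k)).
  by move=> f cf; have [] := cvg_test_continuous mu1 nu1 mom cf.
apply: (cvg_test_moments mu1 nu1 r0 test1) => z z0.
rewrite !lt_min => /andP[/andP[zr1 z4] zL].
have z2 : z < 2^-1 by lra.
have {}zL : z * fixpoint_lip sigma2 <= 2^-1 by rewrite -ler_pdivlMr// ltW.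
have wE := fixed z z0 zr1; set w := psi_transform nu (ofR z) in wE.
have w1 : Cmod w <= 1.
  by rewrite (le_trans (Cmod_psi_transform_le nu z0 z2))//; lra.
have cpsi := continuous_psi_integrand z0 z2.
have d0 : 2 * limit_defect sigma2 n @[n --> \oo] --> (0 : R).
  by rewrite -[X in _ --> X](mulr0 2); apply: cvgMr; exact: limit_defect_cvg0.
have b2 : \forall n \near \oo, expR (sigma2 / n%:R) <= 2.
  have := cvg_expR_div_nat sigma2.
  by move/cvgr_le; apply; rewrite ltr1n.
split; split; try exact: continuous_Re_fun; try exact: continuous_Im_fun.
- apply: cvg_of_norm_le d0; near=> n.
  rewrite [\int[nu]_u _](_ : _ = complex.Re w)// empirical_psi_Re//.
  set t := z * _; have -> : t - complex.Re w = complex.Re (ofR t - w).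
    by rewrite ReD ReN.
  rewrite (le_trans (Re_le_Cmod _))// empirical_psi_dist// ?(ltW z4)//.
    by near: n; exact: nbhs_infty_gt.
  by near: n.
- apply: cvg_of_norm_le d0; near=> n.
  rewrite [\int[nu]_u _](_ : _ = complex.Im w)// empirical_psi_Im//.
  set h := cauchy_mean (herm_zeros (herm_param sigma2 n) n) z.
  (* The empirical psi-transform at real z is the real number z h, so the same distance bound
     controls the imaginary part. *)
  have -> : 0 - complex.Im w = complex.Im (ofR (z * h) - w).
    by rewrite ImD ImN.
  rewrite (le_trans (Im_le_Cmod _))// empirical_psi_dist// ?(ltW z4)//.
    by near: n; exact: nbhs_infty_gt.
  by near: n.
Unshelve. all: by end_near. Qed.
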